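(* Assume that the entries of $E$ are independent $N(0,\sigma^2)$ random variables. Let $q=r(X)$, let $\theta,\xi>0$ be arbitrary, let $c(\theta)=1+2/\theta$, set $$\mu=(1+\theta)(1+\xi)^2(\sqrt n+\sqrt q)^2\sigma^2,\qquad \mathrm{pen}(B)=\mu\, r(B),$$ and let $\hat A$ be a minimizer of $\|Y-XB\|_F^2+\mathrm{pen}(B)$ over all $p\times n$ matrices $B$. Then $$\mathbb{P}\left[\|X\hat A-XA\|_F^2\le\min_{1\le k\le\min(n,p)}\left\{c^2(\theta)\sum_{j>k}d_j^2(XA)+2c(\theta)\mu k\right\}\right]\ge 1-\exp\left\{-\frac{\xi^2(n+q)}{2}\right\}$$ and $$\mathbb{E}\left[\|X\hat A-XA\|_F^2\right]\le\min_{1\le k\le\min(n,p)}\left[c^2(\theta)\sum_{j>k}d_j^2(XA)+2(1+\theta)c(\theta)(1+\xi)^2\sigma^2(\sqrt n+\sqrt q)^2k\right]$$ $$\qquad+\,4(1+\theta)c(\theta)\min(n,p)\,\sigma^2(1+\xi^{-1})\exp\left(-\frac{\xi^2(n+q)}{2}\right).$$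
   Context: Multivariate response regression model: $Y=XA+E$, where $Y$ is the $m\times n$ response matrix, $X$ is a fixed (nonrandom) $m\times p$ matrix, $A$ is an unknown fixed $p\times n$ matrix, and $E$ is a random $m\times n$ matrix. For a matrix $C$, $r(C)$ is its rank, $\|C\|_F$ its Frobenius norm, and $d_1(C)\ge d_2(C)\ge\cdots$ its singular values in decreasing order ($d_j(C)=0$ for $j$ larger than the rank of $C$). *)

(* Defs.v *)
From HB Require Import structures.
From mathcomp Require Import all_boot all_order all_algebra.
From mathcomp Require Import spectral complex.
From mathcomp Require Import all_classical all_reals all_analysis.

Set Implicit Arguments.
Unset Strict Implicit.
Unset Printing Implicit Defensive.

Import Order.TTheory GRing.Theory Num.Theory.

Local Open Scope classical_set_scope.
Local Open Scope ring_scope.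

(* Singular values, in decreasing order: the square roots of the n eigenvalues
   of the symmetric positive semidefinite matrix C^T *m C, counted with
   multiplicity. The eigenvalues are read off the unitary diagonalisation,
   which is available over the closed field R[i] only; they are real, so that
   taking real parts loses nothing. *)
Definition singular_values (R : realType) (m n : nat) (C : 'M[R]_(m, n)) :
    seq R :=
  let ev := spectral_diag (map_mx (real_complex R) (C^T *m C)) in
  sort >=%R [seq Num.sqrt (complex.Re (ev 0 i)) | i <- enum 'I_n].

(* The index j is 1-based: the largest singular value is singval C 1. The value
   is 0 beyond the rank of C, in particular for j > n. *)
Definition singval (R : realType) (m n : nat) (C : 'M[R]_(m, n)) (j : nat) : R :=
  (singular_values C)`_j.-1.

Definition frobenius_norm (R : realType) (m n : nat) (C : 'M[R]_(m, n)) : R :=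
  Num.sqrt (\sum_(i < m) \sum_(j < n) C i j ^+ 2).

(* Meant for 0 < N: the default value f 1 of the iterated operation is then one
   of the terms, so it does not affect the minimum. *)
Definition min_upto (R : realType) (N : nat) (f : nat -> R) : R :=
  \big[Num.min/f 1%N]_(1 <= k < N.+1) f k.

(* A random matrix is a matrix whose entries are random variables. *)
Definition realization (R : realType) (d : measure_display)
    (T : measurableType d) (P : probability T R) (m n : nat)
    (M : 'M[{RV P >-> R}]_(m, n)) (w : T) : 'M[R]_(m, n) :=
  \matrix_(i, j) M i j w.

Definition mutually_independent (R : realType) (d : measure_display)
    (T : measurableType d) (P : probability T R) (I : finType)
    (Z : I -> {RV P >-> R}) : Prop :=
  forall (J : {set I}) (B : I -> set R),
    (forall i, measurable (B i)) ->
    P (\bigcap_(i in [set` J]) (Z i @^-1` B i)) =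
    (\prod_(i in J) P (Z i @^-1` B i))%E.

(* Main.v *)
(* Let the rows of Q be an orthonormal basis of the column space of X, let D be
   the operator norm of the q x n Gaussian matrix Q E, and let tau =
   (1 + xi) (sqrt n + sqrt q) sigma. Comparing the criterion at Ahat and at A P,
   where P projects onto the leading right singular directions of X A, and
   bounding <E, X (Ahat - A P)> by D sqrt(rank) |X (Ahat - A P)|_F, one gets the
   oracle bound up to a multiple of max(0, D^2 - tau^2). Both claims then follow
   from the exponential moments
     E exp(lam D) <= exp(lam sigma (sqrt n + sqrt q) + lam^2 sigma^2 / 2).
   These come from a comparison of Gaussian processes rather than from
   concentration of measure: for unit vectors u, v the process u (Q E) v^T + sigma z
   has the same variances as sigma (<g, u> + <h, v>) and larger covariances.
   The comparison is proved first for f / (f + 1), f = sum_i exp(beta x_i), by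
   splitting each Gaussian into N small independent ones: each of the N steps
   costs O(N^(-3/2)), by a second order expansion. Integrating over a shift of
   x gives the comparison for f^(lam / beta), hence, as beta grows, for
   exp(lam max_i x_i). *)
Require Import Defs.
From HB Require Import structures.
From mathcomp Require Import all_boot all_order all_algebra.
From mathcomp Require Import all_classical all_reals all_analysis.
From mathcomp Require Import spectral complex measurable_realfun ring lra.

Set Implicit Arguments.
Unset Strict Implicit.
Unset Printing Implicit Defensive.

Import Order.TTheory GRing.Theory Num.Theory.
Import numFieldNormedType.Exports.

Local Open Scope classical_set_scope.
Local Open Scope ring_scope.

(** * Invariance of Lebesgue integrals under shifts and reflection *)

Section Lebesgue.
Context {R : realType}.
Implicit Types f : R -> \bar R.
Local Notation mu := (@lebesgue_measure R).

(** The average of a sum of exponentials sees variances only, so a concave function of it has to be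
    compared. For f / (f + 1) the remainder of the expansion is at most |W - 1|^3, where W is the
    sum divided by its average: the estimate is uniform in the point. The second order coefficient
    is negative, so larger covariances lower the average.

    Expectations are written as iterated Lebesgue integrals over translations of the argument. These
    operators commute, preserve order and fix constants, hence the errors of the N steps simply add.

    The Gaussian sigma z contributes a factor exp(lam^2 sigma^2 / 2) on the side of the matrix,
    while the norms of g and h cost the same factor each; the quotient leaves the term lam^2 sigma^2
    / 2 of the bound.

    The operator norm is a supremum over uncountably many pairs of vectors. It is reached through a
    countable dense family, finite maxima and monotone convergence, in the form of a measurable
    function that is either exp(lam D) for an upper bound D of the norm, or infinite. *)

Lemma ge0_integral_shift f (c : R) : measurable_fun [set: R] f ->
  (forall x, 0 <= f x)%E ->
  (\int[mu]_x f (x + c)%R = \int[mu]_x f x)%E.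
Proof.
move=> mf f0.
pose T (x : measurableTypeR R) : measurableTypeR R := (x : R) + c.
have mT : measurable_fun [set: measurableTypeR R] T.
  by apply: measurable_funD => //; exact: measurable_id.
rewrite -[LHS](@ge0_integral_pushforward _ _ _ _ _ T mT mu setT f)//.
apply: eq_measure_integral => //= A mA _.
apply/esym/lebesgue_measure_unique => //= _ [[a b]] _ <-.
rewrite /pushforward.
have -> : T @^-1` `]a, b] = `]a - c, b - c]%classic.
  by apply/seteqP; split=> x /=; rewrite !in_itv/= ltrBlDr lerBrDr.
rewrite !lebesgue_measure_itv/= !lte_fin ltrD2r; case: ifP => // _.
by rewrite -!EFinD; congr (_%:E); ring.
Qed.

Lemma ge0_integral_opp f : measurable_fun [set: R] f ->
  (forall x, 0 <= f x)%E ->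
  (\int[mu]_x f (- x)%R = \int[mu]_x f x)%E.
Proof.
move=> mf f0.
pose T (x : measurableTypeR R) : measurableTypeR R := - (x : R).
have mT : measurable_fun [set: measurableTypeR R] T.
  by apply: measurable_funN => //; exact: measurable_id.
rewrite -[LHS](@ge0_integral_pushforward _ _ _ _ _ T mT mu setT f)//.
apply: eq_measure_integral => //= A mA _.
exact: lebesgue_measureN.
Qed.

End Lebesgue.

(** * Averaging along lines *)

Section Smear.
Context {R : realType} {K : nat}.
Local Notation mu := (@lebesgue_measure R).
Local Notation S := (K.-tuple (measurableTypeR R)).

Definition transl (x : S) (a : 'I_K -> R) (t : R) : S :=
  [tuple tnth x i + t * a i | i < K].

Lemma tnth_transl x a t i : tnth (transl x a t) i = tnth x i + t * a i.
Proof. by rewrite tnth_mktuple. Qed.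

Lemma translC x a b t u : transl (transl x a t) b u = transl (transl x b u) a t.
Proof. by apply: eq_from_tnth => i; rewrite !tnth_transl addrAC. Qed.

Lemma translD x a t u : transl (transl x a t) a u = transl x a (t + u).
Proof. by apply: eq_from_tnth => i; rewrite !tnth_transl mulrDl addrA. Qed.

Lemma measurable_transl a :
  measurable_fun setT (fun z : S * measurableTypeR R => transl z.1 a z.2).
Proof.
apply/measurable_fun_tnthP => i.
rewrite (_ : _ \o _ = fun z => tnth z.1 i + z.2 * a i); last first.
  by apply/funext => z /=; rewrite tnth_transl.
apply: measurable_funD; last exact: measurable_funM.
by apply: (@measurableT_comp _ _ _ _ _ _ (fun x : S => tnth x i)) => //=; exact: measurable_tnth.
Qed.

Definition nnm d (T : measurableType d) (f : T -> \bar R) :=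
  measurable_fun setT f /\ forall x, (0 <= f x)%E.

(** For the density [k] of N(0, s^2) this is the expectation of [f] at x + g a. The weight stays
    arbitrary because one of infinite mass, [expR (lam * r)], is used later to average over common
    shifts. *)
Definition smear (k : R -> R) (a : 'I_K -> R) (f : S -> \bar R) (x : S) : \bar R :=
  (\int[mu]_t ((k t)%:E * f (transl x a t)))%E.

Definition weight (k : R -> R) := measurable_fun setT k /\ forall t, 0 <= k t.

Lemma measurable_smear_body k a f : weight k -> nnm f ->
  measurable_fun setT
    (fun z : S * measurableTypeR R => ((k z.2)%:E * f (transl z.1 a z.2))%E).
Proof.
move=> [mk k0] [mf f0].
apply: emeasurable_funM.
  by apply/measurable_EFinP; exact: measurableT_comp.
exact: measurableT_comp mf (measurable_transl a).
Qed.

Lemma measurable_smear_body1 k a f x : weight k -> nnm f ->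
  measurable_fun setT (fun t : R => ((k t)%:E * f (transl x a t))%E).
Proof.
move=> kk ff.
exact: (measurable_fun_pair2 x (measurable_smear_body a kk ff)).
Qed.

Lemma smear_body_ge0 k a f x t : weight k -> nnm f ->
  (0 <= (k t)%:E * f (transl x a t))%E.
Proof. by move=> [_ k0] [_ f0]; rewrite mule_ge0// lee_fin. Qed.

Lemma smear_nnm k a f : weight k -> nnm f -> nnm (smear k a f).
Proof.
move=> kk ff; split=> [|x].
  apply: (@measurable_fun_fubini_tonelli_F _ _ _ _ _ mu
    (fun z : S * measurableTypeR R => ((k z.2)%:E * f (transl z.1 a z.2))%E)) => //=.
    exact: measurable_smear_body.
  by move=> z; exact: smear_body_ge0.
by apply: integral_ge0 => t _; exact: smear_body_ge0.
Qed.

(** Translations commute, so Tonelli's theorem applies to the double integral. Every later exchange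
    of averages comes down to this. *)
Lemma smearC k k' a b f x : weight k -> weight k' -> nnm f ->
  smear k a (smear k' b f) x = smear k' b (smear k a f) x.
Proof.
move=> kk kk' ff; rewrite /smear.
pose F (z : measurableTypeR R * measurableTypeR R) :=
  ((k z.1)%:E * ((k' z.2)%:E * f (transl (transl x a z.1) b z.2)))%E.
have F0 z : (0 <= F z)%E.
  by apply: mule_ge0; [rewrite lee_fin kk.2|exact: smear_body_ge0].
have mF : measurable_fun setT F.
  apply: emeasurable_funM.
    by apply/measurable_EFinP; apply: measurableT_comp kk.1 _.
  apply: (@measurableT_comp _ _ _ _ _ _ _ setT
     (fun z : measurableTypeR R * measurableTypeR R => (transl x a z.1, z.2))
     (measurable_smear_body b kk' ff)).
  apply: measurable_fun_pair => //=.
  exact: (measurableT_comp (measurable_fun_pair2 x (measurable_transl a))).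
transitivity (\int[mu]_t \int[mu]_u F (t, u))%E.
  apply: eq_integral => t _ /=; rewrite -ge0_integralZl//=.
  - exact: measurable_smear_body1.
  - by move=> u _; exact: smear_body_ge0.
  - by rewrite lee_fin kk.2.
rewrite fubini_tonelli//.
apply: eq_integral => u _ /=; rewrite /F/= -ge0_integralZl//=.
- by apply: eq_integral => t _; rewrite translC muleCA.
- exact: measurable_smear_body1.
- by move=> t _; exact: smear_body_ge0.
- by rewrite lee_fin kk'.2.
Qed.

Lemma smear_le k a f g x : weight k -> nnm f -> nnm g ->
  (forall y, f y <= g y)%E -> (smear k a f x <= smear k a g x)%E.
Proof.
move=> kk ff gg fg; apply: ge0_le_integral => //.
- by move=> t _; exact: smear_body_ge0.
- exact: measurable_smear_body1.
- exact: measurable_smear_body1.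
- by move=> t _; rewrite lee_wpmul2l// lee_fin kk.2.
Qed.

Lemma smearD k a f g x : weight k -> nnm f -> nnm g ->
  smear k a (fun y => f y + g y)%E x = (smear k a f x + smear k a g x)%E.
Proof.
move=> kk ff gg; rewrite /smear -ge0_integralD//; last 4 first.
- by move=> t _; exact: smear_body_ge0.
- exact: measurable_smear_body1.
- by move=> t _; exact: smear_body_ge0.
- exact: measurable_smear_body1.
by apply: eq_integral => t _; rewrite ge0_muleDr// ?ff.2 ?gg.2.
Qed.

Lemma smearZ k a c f x : weight k -> nnm f -> (0 <= c)%R ->
  smear k a (fun y => c%:E * f y)%E x = (c%:E * smear k a f x)%E.
Proof.
move=> kk ff c0; rewrite /smear -ge0_integralZl//=.
- by apply: eq_integral => t _; rewrite muleCA.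
- exact: measurable_smear_body1.
- by move=> t _; exact: smear_body_ge0.
Qed.

End Smear.

(** * Gaussian densities, their exponential moments and convolutions *)

Section Gauss.
Context {R : realType}.
Local Notation mu := (@lebesgue_measure R).
Implicit Types s t c : R.

Definition gauss s : R -> R := normal_pdf 0 s.

Lemma weight_gauss s : weight (gauss s).
Proof. by split=> [|t]; [exact: measurable_normal_pdf|exact: normal_pdf_ge0]. Qed.

Lemma normal_peakE s : 0 < s -> normal_peak s = s^-1 * normal_peak 1.
Proof.
move=> s0; rewrite /normal_peak expr1n mul1r -mulrnAr sqrtrM ?sqr_ge0//.
by rewrite sqrtr_sqr gtr0_norm// invfM.
Qed.

Lemma normal_pdf_gt0E m s t : 0 < s -> normal_pdf m s t =
  s^-1 * normal_peak 1 * expR (- (t - m) ^+ 2 / (2 * s ^+ 2)).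
Proof.
move=> s0; rewrite normal_pdfE ?gt_eqF// normal_peakE// /normal_fun.
by rewrite mulr_natl.
Qed.

Lemma gauss_integral s : (\int[mu]_t (gauss s t)%:E = 1)%E.
Proof. exact: integral_normal_pdf. Qed.

(** Completing the square makes the integrand a constant multiple of the normal density of mean s^2
    c. The next two lemmas use the same device with other means and deviations. *)
Lemma gauss_mgf s c : 0 < s ->
  (\int[mu]_t ((gauss s t)%:E * (expR (c * t))%:E) =
   (expR (s ^+ 2 * c ^+ 2 / 2))%:E)%E.
Proof.
move=> s0.
transitivity (\int[mu]_t ((expR (s ^+ 2 * c ^+ 2 / 2))%:E *
    (normal_pdf (s ^+ 2 * c) s t)%:E))%E.
  apply: eq_integral => t _; rewrite -!EFinM; congr (_%:E).
  rewrite /gauss !normal_pdf_gt0E// -[LHS]mulrA -expRD [RHS]mulrCA -expRD.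
  by congr (_ * expR _); field; exact: lt0r_neq0.
rewrite ge0_integralZl//.
- by rewrite integral_normal_pdf mule1.
- by apply/measurable_EFinP; exact: measurable_normal_pdf.
- by move=> t _; rewrite lee_fin normal_pdf_ge0.
Qed.

Lemma gauss_sqr_mgf s c : 0 < s -> 2 * c * s ^+ 2 < 1 ->
  (\int[mu]_t ((gauss s t)%:E * (expR (c * t ^+ 2))%:E) =
   ((Num.sqrt (1 - 2 * c * s ^+ 2))^-1)%:E)%E.
Proof.
move=> s0 a1; set u := Num.sqrt _.
have u0 : 0 < u by rewrite sqrtr_gt0 subr_gt0.
have u2 : u ^+ 2 = 1 - 2 * c * s ^+ 2 by rewrite sqr_sqrtr// subr_ge0 ltW.
have su0 : 0 < s / u by rewrite divr_gt0.
transitivity (\int[mu]_t ((u^-1)%:E * (gauss (s / u) t)%:E))%E.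
  apply: eq_integral => t _; rewrite -!EFinM; congr (_%:E).
  rewrite /gauss !normal_pdf_gt0E// -[LHS]mulrA -expRD [RHS]mulrA.
  congr (_ * expR _); first by field; rewrite !gt_eqF.
  rewrite !subr0 expr_div_n u2; field.
  by rewrite -u2 sqrf_eq0 !gt_eqF.
rewrite ge0_integralZl//.
- by rewrite gauss_integral mule1.
- by apply/measurable_EFinP; exact: measurable_normal_pdf.
- by move=> t _; rewrite lee_fin normal_pdf_ge0.
- by rewrite lee_fin invr_ge0 ltW.
Qed.

Lemma gauss_conv s s' z : 0 < s -> 0 < s' ->
  (\int[mu]_t (gauss s t * gauss s' (z - t))%:E =
   (gauss (Num.sqrt (s ^+ 2 + s' ^+ 2)) z)%:E)%E.
Proof.
move=> s0 s'0; set w := Num.sqrt _.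
have w0 : 0 < w by rewrite sqrtr_gt0 addr_gt0 ?exprn_gt0.
have w2 : w ^+ 2 = s ^+ 2 + s' ^+ 2 by rewrite sqr_sqrtr// addr_ge0 ?sqr_ge0.
have u0 : 0 < s * s' / w by rewrite divr_gt0// mulr_gt0.
transitivity (\int[mu]_t ((gauss w z)%:E *
    (normal_pdf (z * s ^+ 2 / w ^+ 2) (s * s' / w) t)%:E))%E.
  apply: eq_integral => t _; rewrite -!EFinM; congr (_%:E).
  rewrite /gauss !normal_pdf_gt0E// [LHS]mulrACA [RHS]mulrACA -!expRD.
  congr (_ * expR _).
    by field; rewrite !gt_eqF.
  rewrite !expr_div_n exprMn w2; field.
  by rewrite -w2 sqrf_eq0 !gt_eqF.
rewrite ge0_integralZl//.
- by rewrite integral_normal_pdf mule1.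
- by apply/measurable_EFinP; exact: measurable_normal_pdf.
- by move=> t _; rewrite lee_fin normal_pdf_ge0.
- by rewrite lee_fin normal_pdf_ge0.
Qed.

End Gauss.

Section GaussSmear.
Context {R : realType} {K : nat}.
Local Notation mu := (@lebesgue_measure R).
Local Notation S := (K.-tuple (measurableTypeR R)).
Implicit Types (a b : 'I_K -> R) (l : seq ('I_K -> R)) (f g : S -> \bar R).

Lemma nnm_cst d (T : measurableType d) (c : R) : 0 <= c ->
  nnm (fun _ : T => c%:E).
Proof. by move=> c0; split=> [|x]; [exact: measurable_cst|rewrite lee_fin]. Qed.

Lemma nnmD d (T : measurableType d) (f g : T -> \bar R) :
  nnm f -> nnm g -> nnm (fun x => f x + g x)%E.
Proof.
move=> [mf f0] [mg g0]; split=> [|x]; first exact: emeasurable_funD.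
by rewrite adde_ge0.
Qed.

Lemma nnmZ d (T : measurableType d) (c : R) (f : T -> \bar R) : 0 <= c ->
  nnm f -> nnm (fun x => c%:E * f x)%E.
Proof.
move=> c0 [mf f0]; split=> [|x]; first by apply: emeasurable_funM.
by rewrite mule_ge0.
Qed.

Lemma smear_cst s a (c : R) x : 0 <= c ->
  smear (gauss s) a (fun=> c%:E) x = c%:E.
Proof.
move=> c0; rewrite /smear ge0_integralZr//.
- by rewrite gauss_integral mul1e.
- by apply/measurable_EFinP; exact: (weight_gauss s).1.
- by move=> t _; rewrite lee_fin (weight_gauss s).2.
Qed.

Lemma smear_conv s s' a f x : 0 < s -> 0 < s' -> nnm f ->
  smear (gauss s) a (smear (gauss s') a f) x =
  smear (gauss (Num.sqrt (s ^+ 2 + s' ^+ 2))) a f x.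
Proof.
move=> s0 s'0 ff.
pose phi z := f (transl x a z).
pose F (z : measurableTypeR R * measurableTypeR R) :=
  ((gauss s z.1)%:E * ((gauss s' (z.2 - z.1)%R)%:E * phi z.2))%E.
have mphi : measurable_fun [set: measurableTypeR R] phi.
  apply: (measurableT_comp ff.1).
  exact: (measurable_fun_pair2 x (measurable_transl a)).
have phi0 z : (0 <= phi z)%E by exact: ff.2.
have F0 z : (0 <= F z)%E.
  by rewrite /F !mule_ge0// lee_fin (weight_gauss _).2.
have mF : measurable_fun setT F.
  apply: emeasurable_funM.
    by apply/measurable_EFinP; apply: measurableT_comp (weight_gauss s).1 _.
  apply: emeasurable_funM; last exact: measurableT_comp.
  apply/measurable_EFinP; apply: measurableT_comp (weight_gauss s').1 _.
  exact: measurable_funB.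
pose G t z := ((gauss s' (z - t)%R)%:E * phi z)%E.
have mG t : measurable_fun [set: measurableTypeR R] (G t).
  apply: emeasurable_funM; last exact: mphi.
  apply/measurable_EFinP; apply: measurableT_comp (weight_gauss s').1 _.
  exact: measurable_funB.
have G0 t z : (0 <= G t z)%E by rewrite mule_ge0// lee_fin (weight_gauss _).2.
have FE t : (\int[mu]_z F (t, z) = (gauss s t)%:E * \int[mu]_z G t z)%E.
  rewrite -(ge0_integralZl _ measurableT (mG t)) ?lee_fin ?(weight_gauss _).2 // => z _; exact: G0.
have GE t : (\int[mu]_z G t z = smear (gauss s') a f (transl x a t))%E.
  rewrite -(ge0_integral_shift t (mG t) (G0 t)).
  by apply: eq_integral => u _; rewrite /G /phi translD addrK addrC.
transitivity (\int[mu]_t \int[mu]_z F (t, z))%E.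
  by apply: eq_integral => t _; rewrite FE GE.
rewrite (fubini_tonelli _ mF F0).
apply: eq_integral => z _.
have -> : (\int[mu]_t F (t, z) =
    \int[mu]_t ((gauss s t * gauss s' (z - t))%:E * phi z))%E.
  by apply: eq_integral => t _; rewrite /F muleA -EFinM.
rewrite -gauss_conv//; apply: ge0_integralZr => //.
- apply/measurable_EFinP; apply: measurable_funM; first exact: (weight_gauss s).1.
  apply: measurableT_comp (weight_gauss s').1 _.
  exact: measurable_funB.
- by move=> t _; rewrite lee_fin mulr_ge0 ?(weight_gauss _).2.
Qed.

(** Exponentials of linear forms are eigenfunctions of all Gaussian averages ([smear_expdot]); the
    explicit averages below come from expansions into them. *)
Definition expdot b (x : S) : \bar R := (expR (\sum_i b i * tnth x i))%:E.

Lemma nnm_expdot b : nnm (expdot b).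
Proof.
split=> [|x]; last by rewrite lee_fin expR_ge0.
apply/measurable_EFinP; apply: measurableT_comp; first exact: measurable_expR.
apply: measurable_sum => i; apply: measurable_funM => //.
exact: (@measurable_tnth _ (measurableTypeR R)).
Qed.

Lemma smear_expdot s a b x : 0 < s -> smear (gauss s) a (expdot b) x =
  ((expR (s ^+ 2 * (\sum_i b i * a i) ^+ 2 / 2))%:E * expdot b x)%E.
Proof.
move=> s0; set c := \sum_i _ * _.
have -> : smear (gauss s) a (expdot b) x =
    (\int[mu]_t ((gauss s t * expR (c * t))%:E * expdot b x))%E.
  apply: eq_integral => t _; rewrite EFinM -muleA; congr (_ * _)%E.
  rewrite -EFinM -expRD; congr (expR _)%:E; rewrite mulr_suml -big_split/=.
  by apply: eq_bigr => i _; rewrite tnth_transl; ring.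
rewrite -gauss_mgf//; apply: ge0_integralZr => //.
- apply/measurable_EFinP; apply: measurable_funM; first exact: (weight_gauss s).1.
  by apply: measurableT_comp => //; exact: measurable_funM.
- by move=> t _; rewrite lee_fin mulr_ge0 ?(weight_gauss _).2 ?expR_ge0.
- by rewrite lee_fin expR_ge0.
Qed.

(* [gsmear s l f x] is the expectation of [f (x + \sum_(a <- l) g_a a)] for
   independent [g_a] of law N(0, s^2), as an iterated Lebesgue integral. *)
Definition gsmear s l f : S -> \bar R := foldr (smear (gauss s)) f l.

Lemma gsmear_cat s l1 l2 f :
  gsmear s (l1 ++ l2) f = gsmear s l1 (gsmear s l2 f).
Proof. by rewrite /gsmear foldr_cat. Qed.

Lemma gsmear_nnm s l f : nnm f -> nnm (gsmear s l f).
Proof.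
by move=> ff; elim: l => //= a l IH; apply: smear_nnm => //; exact: weight_gauss.
Qed.

Lemma smear_gsmear k a s l f : weight k -> nnm f ->
  smear k a (gsmear s l f) = gsmear s l (smear k a f).
Proof.
move=> kk ff; elim: l => //= b l <-; apply/funext => x.
by apply: smearC => //; [exact: weight_gauss|exact: gsmear_nnm].
Qed.

Lemma gsmearC s s' l l' f : nnm f ->
  gsmear s l (gsmear s' l' f) = gsmear s' l' (gsmear s l f).
Proof.
move=> ff; elim: l => //= a l ->.
by rewrite smear_gsmear//; [exact: weight_gauss|exact: gsmear_nnm].
Qed.

Lemma gsmear_le s l f g : nnm f -> nnm g -> (forall x, f x <= g x)%E ->
  forall x, (gsmear s l f x <= gsmear s l g x)%E.
Proof.
move=> ff gg fg; elim: l => //= a l IH x.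
by apply: smear_le => //; [exact: weight_gauss|exact: gsmear_nnm|exact: gsmear_nnm].
Qed.

Lemma gsmearD s l f g : nnm f -> nnm g ->
  gsmear s l (fun x => f x + g x)%E =
  (fun x => gsmear s l f x + gsmear s l g x)%E.
Proof.
move=> ff gg; elim: l => //= a l ->; apply/funext => x.
by apply: smearD; [exact: weight_gauss|exact: gsmear_nnm|exact: gsmear_nnm].
Qed.

Lemma gsmearZ s l (c : R) f : 0 <= c -> nnm f ->
  gsmear s l (fun x => c%:E * f x)%E = (fun x => c%:E * gsmear s l f x)%E.
Proof.
move=> c0 ff; elim: l => //= a l ->; apply/funext => x.
by apply: smearZ => //; [exact: weight_gauss|exact: gsmear_nnm].
Qed.

Lemma gsmear_cst s l (c : R) : 0 <= c -> gsmear s l (fun=> c%:E) = fun=> c%:E.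
Proof.
by move=> c0; elim: l => //= a l ->; apply/funext => x; rewrite smear_cst.
Qed.

Lemma gsmear_expdot s l b x : 0 < s -> gsmear s l (expdot b) x =
  ((expR (s ^+ 2 * (\sum_(a <- l) (\sum_i b i * a i) ^+ 2) / 2))%:E *
   expdot b x)%E.
Proof.
move=> s0; elim: l x => [|a l IH] x /=.
  by rewrite big_nil mulr0 mul0r expR0 mul1e.
rewrite (funext IH : gsmear s l (expdot b) = _) smearZ ?expR_ge0//; last 2 first.
- exact: weight_gauss.
- exact: nnm_expdot.
rewrite smear_expdot// muleA -EFinM -expRD big_cons EFinM.
 congr (_ * _)%E; congr (expR _)%:E; ring.
Qed.

Lemma iter_nnm (H : (S -> \bar R) -> S -> \bar R) n f :
  (forall g, nnm g -> nnm (H g)) -> nnm f -> nnm (iter n H f).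
Proof. by move=> HH ff; elim: n => //= n; exact: HH. Qed.

Lemma iter_smear s a n f : 0 < s -> nnm f ->
  iter n.+1 (smear (gauss s) a) f =
  smear (gauss (Num.sqrt n.+1%:R * s)) a f.
Proof.
move=> s0 ff; elim: n => [|n IH]; first by rewrite /= sqrtr1 mul1r.
have n0 : 0 < Num.sqrt n.+1%:R * s by rewrite mulr_gt0// sqrtr_gt0.
rewrite iterS IH; apply/funext => x; rewrite (smear_conv _ _ s0 n0 ff).
congr (smear (gauss _) a f x).
rewrite exprMn sqr_sqrtr// -[X in X + _]mul1r -mulrDl nat1r.
by rewrite sqrtrM// sqrtr_sqr gtr0_norm.
Qed.

Lemma iter_smear_gsmear k a s l f n : weight k -> nnm f ->
  iter n (smear k a \o gsmear s l) f =
  iter n (smear k a) (iter n (gsmear s l) f).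
Proof.
move=> kk ff; elim: n => //= n ->; congr (smear k a _).
have gg : nnm (iter n (gsmear s l) f).
  by apply: iter_nnm => // g; exact: gsmear_nnm.
elim: n (iter n _ f) gg => //= n IH g gg.
rewrite -smear_gsmear ?IH//.
by apply: iter_nnm => // h; exact: smear_nnm.
Qed.

(** Read from right to left, this splits every Gaussian into n + 1 independent ones of smaller
    variance. Averages in different directions commute, so the iterates can be collected direction
    by direction. *)
Lemma iter_gsmear s l n f : 0 < s -> nnm f ->
  iter n.+1 (gsmear s l) f = gsmear (Num.sqrt n.+1%:R * s) l f.
Proof.
move=> s0 ff; elim: l => [|a l IH].
  by rewrite /gsmear/=; elim: n => //= n ->.
rewrite (iter_smear_gsmear a s l n.+1 (weight_gauss s) ff) IH iter_smear//.
exact: gsmear_nnm.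
Qed.

End GaussSmear.

(** * Slepian-type comparison *)

Section LinComb.
Context {R : realType} {K : nat}.
Local Notation S := (K.-tuple (measurableTypeR R)).
Implicit Types (l : seq ('I_K -> R)).

Definition expsum (J : Type) (r : seq J) (c : J -> R) (b : J -> 'I_K -> R)
    (z : S) : R :=
  \sum_(j <- r) c j * expR (\sum_i b j i * tnth z i).

Lemma nnm_expsum (J : Type) (r : seq J) c b : (forall j, 0 <= c j) ->
  nnm (fun z => (@expsum J r c b z)%:E).
Proof.
move=> c0; elim: r => [|j r IH].
  by rewrite (_ : (fun _ => _) = fun=> 0%:E) ?funeqE => [|z];
    [exact: nnm_cst|rewrite /expsum big_nil].
rewrite (_ : (fun _ => _) = fun z =>
    ((c j)%:E * expdot (b j) z + (expsum r c b z)%:E)%E) ?funeqE => [|z].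
  by apply: nnmD => //; apply: nnmZ => //; exact: nnm_expdot.
by rewrite /expsum big_cons EFinD EFinM.
Qed.

Lemma gsmear_expsum (J : Type) (r : seq J) c b s l x : 0 < s ->
  (forall j, 0 <= c j) ->
  gsmear s l (fun z => (@expsum J r c b z)%:E) x =
  (\sum_(j <- r) c j * expR (s ^+ 2 * (\sum_(a <- l) (\sum_i b j i * a i) ^+ 2) / 2
     + \sum_i b j i * tnth x i))%:E.
Proof.
move=> s0 c0; elim: r => [|j r IH].
  rewrite (_ : (fun _ => _) = fun=> 0%:E) ?gsmear_cst ?big_nil//.
  by apply/funext => z; rewrite /expsum big_nil.
rewrite (_ : (fun _ => _) = fun z =>
    ((c j)%:E * expdot (b j) z + (expsum r c b z)%:E)%E); last first.
  by apply/funext => z; rewrite /expsum big_cons EFinD EFinM.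
rewrite gsmearD; last 2 first.
- by apply: nnmZ => //; exact: nnm_expdot.
- exact: nnm_expsum.
rewrite gsmearZ//; last exact: nnm_expdot.
by rewrite IH gsmear_expdot// big_cons EFinD EFinM expRD EFinM.
Qed.

End LinComb.

Section Algebra.
Context {R : realType}.
Implicit Types (b W eta : R).

Lemma jensen_sqr (I : finType) (p t : I -> R) : (forall i, 0 <= p i) ->
  \sum_i p i = 1 -> (\sum_i p i * t i) ^+ 2 <= \sum_i p i * t i ^+ 2.
Proof.
move=> p0 p1; set T := \sum_i p i * t i.
rewrite -subr_ge0.
have -> : \sum_i p i * t i ^+ 2 - T ^+ 2 = \sum_i p i * (t i - T) ^+ 2.
  transitivity (\sum_i (p i * t i ^+ 2 - 2 * T * (p i * t i) + T ^+ 2 * p i)).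
    by rewrite !big_split/= -mulr_sumr p1 sumrN -mulr_sumr -/T; ring.
  by apply: eq_bigr => i _; ring.
by apply: sumr_ge0 => i _; rewrite mulr_ge0// sqr_ge0.
Qed.

Lemma jensen_pow4 (I : finType) (p t : I -> R) : (forall i, 0 <= p i) ->
  \sum_i p i = 1 -> (\sum_i p i * t i) ^+ 4 <= \sum_i p i * t i ^+ 4.
Proof.
move=> p0 p1; rewrite (exprM _ 2 2).
apply: (@le_trans _ _ ((\sum_i p i * t i ^+ 2) ^+ 2)).
  by rewrite ler_sqr ?nnegrE ?sqr_ge0 ?sumr_ge0// => [|i _];
    [exact: jensen_sqr|rewrite mulr_ge0 ?sqr_ge0].
apply: le_trans (jensen_sqr _ p0 p1) _.
by apply: ler_sum => i _; rewrite -exprM.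
Qed.

(* The cubic remainder is split by AM-GM into second and fourth powers of
   [W - 1], whose Gaussian averages are explicit. *)
Lemma frac_taylor b W eta M : 0 < b -> 0 <= W -> 0 < eta ->
  (W - 1) ^+ 4 <= M ->
  `|W / (W + b) - ((1 + b)^-1 + b / (1 + b) ^+ 2 * (W - 1)
     - b / (1 + b) ^+ 3 * (W - 1) ^+ 2)|
  <= (eta * (W - 1) ^+ 2 + M / eta) / 2.
Proof.
move=> b0 W0 eta0 WM; set r := W - 1.
have Wb : 0 < W + b by rewrite ltr_wpDl.
have b1 : 0 < 1 + b by rewrite addr_gt0.
have -> : W / (W + b) - ((1 + b)^-1 + b / (1 + b) ^+ 2 * r
     - b / (1 + b) ^+ 3 * r ^+ 2) = b / (W + b) / (1 + b) ^+ 3 * r ^+ 3.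
  by rewrite /r; field; rewrite !gt_eqF.
rewrite normrM ger0_norm; last by rewrite !divr_ge0 ?exprn_ge0// ltW.
apply: (@le_trans _ _ (`|r| ^+ 3)).
  rewrite normrX ler_piMl ?exprn_ge0// mulr_ile1 ?divr_ge0 ?invr_ge0 ?exprn_ge0 ?(ltW b0) ?(ltW Wb) ?(ltW b1)//.
    by rewrite ler_pdivrMr// mul1r lerDr.
  by rewrite invf_le1 ?exprn_gt0// exprn_ege1// lerDl ltW.
have e0 : 0 <= (eta - `|r|) ^+ 2 * r ^+ 2 / eta.
  by rewrite divr_ge0 ?(ltW eta0)// mulr_ge0// sqr_ge0.
have Me : r ^+ 4 / eta <= M / eta by rewrite ler_pM2r// invr_gt0.
rewrite ler_pdivlMr//.
apply: (@le_trans _ _ (eta * r ^+ 2 + r ^+ 4 / eta)); last by rewrite lerD2l.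
rewrite -subr_ge0; apply: le_trans e0 _.
rewrite le_eqVlt; apply/orP; left; apply/eqP.
have -> : r ^+ 4 = `|r| ^+ 4 by rewrite -normrX ger0_norm// exprn_even_ge0.
have -> : r ^+ 2 = `|r| ^+ 2 by rewrite -normrX ger0_norm// sqr_ge0.
by field; rewrite gt_eqF.
Qed.

End Algebra.

(** * Second order expansion of a single averaging step *)

Section SoftMax.
Context {R : realType} {K : nat}.
Local Notation S := (K.-tuple (measurableTypeR R)).
Variables (beta : R).

Definition sumexp (z : S) : R := \sum_i expR (beta * tnth z i).

Definition sigmoid (z : S) : R := sumexp z / (sumexp z + 1).

Lemma sumexp_ge0 z : 0 <= sumexp z.
Proof. by apply: sumr_ge0 => i _; exact: expR_ge0. Qed.

Lemma measurable_sumexp : measurable_fun setT sumexp.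
Proof.
apply: measurable_sum => i; apply: measurableT_comp; first exact: measurable_expR.
apply: measurable_funM => //; exact: (@measurable_tnth _ (measurableTypeR R)).
Qed.

Lemma sigmoid_ge0 z : 0 <= sigmoid z.
Proof. by rewrite divr_ge0 ?addr_ge0 ?sumexp_ge0. Qed.

Lemma sigmoid_le1 z : sigmoid z <= 1.
Proof.
by rewrite ler_pdivrMr ?ltr_wpDl ?sumexp_ge0// mul1r lerDl.
Qed.

Lemma nnm_sigmoid : nnm (fun z => (sigmoid z)%:E).
Proof.
split=> [|z]; last by rewrite lee_fin sigmoid_ge0.
apply/measurable_EFinP.
rewrite (_ : sigmoid = fun z => 1 - expR (- ln (sumexp z + 1))); last first.
  apply/funext => z; have z0 : 0 < sumexp z + 1 by rewrite ltr_wpDl ?sumexp_ge0.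
  by rewrite expRN lnK ?posrE// /sigmoid; field; rewrite gt_eqF.
apply: measurable_funB => //; apply: measurableT_comp => //.
apply: measurable_funN; apply: measurableT_comp; first exact: measurable_ln.
by apply: measurable_funD => //; exact: measurable_sumexp.
Qed.

Section step.
Variables (tau v : R) (l : seq ('I_K -> R)) (x : S).
Hypotheses (tau0 : 0 < tau) (K0 : (0 < K)%N).
Hypothesis lv : forall i, \sum_(a <- l) a i ^+ 2 = v.

(** Everything is normalised at x: [u] is the variance of [beta] times an increment, [e i] has
    average 1 under [gsmear tau l] at x, and the [p i] are the relative weights of the exponentials
    there. *)
Let u := tau ^+ 2 * beta ^+ 2 * v.
Let e i (z : S) := expR (beta * (tnth z i - tnth x i) - u / 2).
Let p i := expR (beta * tnth x i) / sumexp x.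

Let Z0 : 0 < sumexp x.
Proof.
apply: lt_le_trans (_ : expR (beta * tnth x (Ordinal K0)) <= _).
  exact: expR_gt0.
by rewrite /sumexp (bigD1 (Ordinal K0))//= lerDl sumr_ge0// => i _; exact: expR_ge0.
Qed.

Let p0 i : 0 <= p i. Proof. by rewrite divr_ge0 ?expR_ge0 ?ltW. Qed.

Let p1 : \sum_i p i = 1.
Proof. by rewrite -mulr_suml divff// gt_eqF. Qed.

Let evals (F : S -> R) (r : R) := nnm (fun z => (F z)%:E) /\
  gsmear tau l (fun z => (F z)%:E) x = r%:E.

Let evalsD F G r q : evals F r -> evals G q -> evals (fun z => F z + G z) (r + q).
Proof.
move=> [F0 Fr] [G0 Gq].
rewrite /evals (_ : (fun z => (F z + G z)%:E) = fun z => ((F z)%:E + (G z)%:E)%E)//.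
by split; [exact: nnmD|rewrite gsmearD// Fr Gq].
Qed.

Let evalsZ c F r : 0 <= c -> evals F r -> evals (fun z => c * F z) (c * r).
Proof.
move=> c0 [F0 Fr].
rewrite /evals (_ : (fun z => (c * F z)%:E) = fun z => (c%:E * (F z)%:E)%E)//.
by split; [exact: nnmZ|rewrite gsmearZ// Fr].
Qed.

Let evals_cst c : 0 <= c -> evals (fun=> c) c.
Proof. by move=> c0; split; [exact: nnm_cst|rewrite gsmear_cst]. Qed.

Let sum_count (s : seq 'I_K) (g : 'I_K -> R) :
  \sum_i (count_mem i s)%:R * g i = \sum_(i <- s) g i.
Proof.
elim: s => [|j s IH]; first by rewrite big_nil big1// => i _; rewrite mul0r.
rewrite big_cons -IH [in RHS](bigD1 j)//= (bigD1 j)//= addrA; congr (_ + _).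
  by rewrite eqxx natrD mulrDl mul1r.
by apply: eq_bigr => i; rewrite eq_sym => /negbTE ->.
Qed.

(** A monomial in the [e i] is the exponential of a linear form, whose coefficients come from the
    multiplicities in the list [s j] of its factors. *)
Let evals_mono (J : Type) (r : seq J) (c : J -> R) (s : J -> seq 'I_K) :
  (forall j, 0 <= c j) ->
  evals (fun z => \sum_(j <- r) c j * \prod_(i <- s j) e i z)
    (\sum_(j <- r) c j * expR (tau ^+ 2 * beta ^+ 2 *
       (\sum_(a <- l) (\sum_(i <- s j) a i) ^+ 2 - (size (s j))%:R * v) / 2)).
Proof.
move=> c0.
pose c' j := c j * expR (- (\sum_(i <- s j) (beta * tnth x i + u / 2))).
pose b j i := (count_mem i (s j))%:R * beta.
have c'0 j : 0 <= c' j by rewrite mulr_ge0 ?expR_ge0.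
have bE j (y : 'I_K -> R) : \sum_i b j i * y i = \sum_(i <- s j) beta * y i.
  by rewrite -[RHS]sum_count; apply: eq_bigr => i _; rewrite mulrA.
rewrite /evals (_ : (fun z => _) = fun z => (expsum r c' b z)%:E); last first.
  apply/funext => z; congr (_%:E); apply: eq_bigr => j _.
  rewrite /c' -expR_sum -mulrA -expRD; congr (_ * expR _).
  rewrite bE -sumrN -big_split; apply: eq_bigr => i _ /=; ring.
split; first exact: nnm_expsum.
rewrite gsmear_expsum//; congr (_%:E); apply: eq_bigr => j _.
have -> : \sum_(a <- l) (\sum_i b j i * a i) ^+ 2 =
    beta ^+ 2 * \sum_(a <- l) (\sum_(i <- s j) a i) ^+ 2.
  by rewrite mulr_sumr; apply: eq_bigr => a _; rewrite bE -mulr_sumr exprMn.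
have -> : c' j = c j *
    expR (- (\sum_i b j i * tnth x i + (size (s j))%:R * (u / 2))).
  rewrite /c' bE big_split/= big_const_seq count_predT iter_addr_0.
  by rewrite [in RHS]mulr_natl.
by rewrite -[LHS]mulrA -expRD; congr (_ * expR _); rewrite /u; ring.
Qed.

(* [sumexp], normalised to have average 1: [sigmoid = W / (W + b)] is expanded
   around [W = 1], and only [Q], the average of [W ^+ 2], sees covariances. *)
Let W z := \sum_i p i * e i z.

Let Q := \sum_i \sum_j p i * p j *
  expR (tau ^+ 2 * beta ^+ 2 * \sum_(a <- l) a i * a j).

Let evals_pow m : evals (fun z => \sum_i p i * e i z ^+ m)
  (expR (u * (m%:R ^+ 2 - m%:R) / 2)).
Proof.
have := evals_mono (index_enum 'I_K) (fun i => nseq m i) p0.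
congr evals.
  apply/funext => z; apply: eq_bigr => i _; congr (_ * _).
  by rewrite big_nseq iter_mulr_1.
transitivity (\sum_i p i * expR (u * (m%:R ^+ 2 - m%:R) / 2)); last first.
  by rewrite -mulr_suml p1 mul1r.
apply: eq_bigr => i _; congr (_ * expR _).
rewrite size_nseq; under eq_bigr do rewrite big_nseq iter_addr_0 -mulr_natl exprMn.
by rewrite -mulr_sumr lv /u; ring.
Qed.

Let evalsW : evals W 1.
Proof.
have := evals_pow 1; rewrite expr1n subrr mulr0 mul0r expR0.
by congr evals; apply/funext => z; apply: eq_bigr => i _; rewrite expr1.
Qed.

Let evalsW2 : evals (fun z => W z ^+ 2) Q.
Proof.
have pp0 (ij : 'I_K * 'I_K) : 0 <= p ij.1 * p ij.2 by rewrite mulr_ge0.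
have := evals_mono (index_enum ('I_K * 'I_K)%type) (fun ij => [:: ij.1; ij.2]) pp0.
congr evals.
  apply/funext => z; rewrite expr2 mulr_suml -(pair_bigA _ (fun i j => p i * p j *
    \prod_(k <- [:: i; j]) e k z))/=; apply: eq_bigr => i _.
  rewrite mulr_sumr; apply: eq_bigr => j _.
  by rewrite big_cons big_seq1; ring.
rewrite -(pair_bigA _ (fun i j => p i * p j * expR (tau ^+ 2 * beta ^+ 2 *
   (\sum_(a <- l) (\sum_(k <- [:: i; j]) a k) ^+ 2 - 2 * v) / 2)))/=.
apply: eq_bigr => i _; apply: eq_bigr => j _; congr (_ * expR _).
have -> : \sum_(a <- l) (\sum_(k <- [:: i; j]) a k) ^+ 2 =
    v + v + 2 * \sum_(a <- l) a i * a j.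
  rewrite -{1}(lv i) -(lv j) mulr_sumr -!big_split; apply: eq_bigr => a _ /=.
  by rewrite big_cons big_seq1; ring.
by field.
Qed.

(** The inverse of the average of [sumexp], so that [sumexp] is [W / b]. *)
Let b := (sumexp x * expR (u / 2))^-1.

Let b0 : 0 < b. Proof. by rewrite invr_gt0 mulr_gt0// expR_gt0. Qed.

Let e0 i z : 0 <= e i z. Proof. exact: expR_ge0. Qed.

Let W0 z : 0 <= W z. Proof. by apply: sumr_ge0 => i _; rewrite mulr_ge0. Qed.

Let sigmoidE z : sigmoid z = W z / (W z + b).
Proof.
have WE : sumexp z = W z / b.
  rewrite /b invrK /W mulr_suml; apply: eq_bigr => i _.
  have -> : beta * tnth z i =
      beta * tnth x i + (beta * (tnth z i - tnth x i) - u / 2) + u / 2 by ring.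
  by rewrite 2!expRD /p /e; field; rewrite gt_eqF.
rewrite /sigmoid WE -[X in _ / (_ + X)](divff (lt0r_neq0 b0)) -mulrDl; field.
by rewrite gt_eqF ?gt_eqF// ltr_wpDl.
Qed.

Let y := expR u.

(* The average of [\sum_i p i * (e i - 1) ^+ 4], which dominates that of [(W - 1) ^+ 4]. *)
Let M := y ^+ 6 - 4 * y ^+ 3 + 6 * y - 3.

(** The bound of [frac_taylor] is averaged: [W - 1] has average 0 and its square has average
    [Q - 1]. The free parameter [eta] balances second against fourth moments. *)
Lemma gsmear_sigmoid_approx eta : 0 < eta -> exists r : R,
  gsmear tau l (fun z => (sigmoid z)%:E) x = r%:E /\
  `|r - ((1 + b)^-1 - b / (1 + b) ^+ 3 * (Q - 1))| <= (eta * (Q - 1) + M / eta) / 2.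
Proof.
move=> eta0.
have fin : (gsmear tau l (fun z => (sigmoid z)%:E) x <= 1%:E)%E.
  have := gsmear_le tau l nnm_sigmoid (nnm_cst S (@ler01 R))
    (fun z => sigmoid_le1 z) x.
  by rewrite gsmear_cst.
pose r := fine (gsmear tau l (fun z => (sigmoid z)%:E) x).
have rE : evals sigmoid r.
  split; first exact: nnm_sigmoid.
  rewrite fineK// ge0_fin_numE ?(le_lt_trans fin) ?ltry//.
  by have [_ ->] := gsmear_nnm tau l nnm_sigmoid.
exists r; split; first by have [] := rE.
have evals_le F G q q' : evals F q -> evals G q' -> (forall z, F z <= G z) -> q <= q'.
  move=> [F0 Fq] [G0 Gq] FG; rewrite -lee_fin -Fq -Gq.
  by apply: gsmear_le => // z; rewrite lee_fin.
set c1 := b / (1 + b) ^+ 2; set c2 := b / (1 + b) ^+ 3.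
have b1 : 0 < 1 + b by rewrite addr_gt0.
have c10 : 0 <= c1 by rewrite divr_ge0 ?exprn_ge0// ltW.
have c20 : 0 <= c2 by rewrite divr_ge0 ?exprn_ge0// ltW.
have h0 : 0 <= (2 * eta)^-1 by rewrite invr_ge0 mulr_ge0// ltW.
pose B m z := \sum_i p i * e i z ^+ m.
(* [gsmear] is handled on nonnegative functions only, so each half of the two-sided bound is
   rearranged to have nonnegative coefficients on both sides before it is averaged. *)
pose P (k0 k1 kq k2 k3 k4 : R) (z : S) :=
  k0 + (k1 * W z + (kq * W z ^+ 2 + (k2 * B 2%N z + (k3 * B 3%N z + k4 * B 4%N z)))).
have evalsP k0 k1 kq k2 k3 k4 : 0 <= k0 -> 0 <= k1 -> 0 <= kq -> 0 <= k2 ->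
    0 <= k3 -> 0 <= k4 -> evals (P k0 k1 kq k2 k3 k4)
      (k0 + (k1 * 1 + (kq * Q + (k2 * y + (k3 * y ^+ 3 + k4 * y ^+ 6))))).
  move=> *; apply: evalsD; first exact: evals_cst.
  apply: evalsD; first exact: evalsZ.
  apply: evalsD; first exact: evalsZ.
  (* The exponent (m^2 - m) / 2 is 1, 3, 6 for m = 2, 3, 4: these are the powers of y in [M]. *)
  have yE m k : (m%:R ^+ 2 - m%:R) / 2 = k%:R :> R ->
      evals (B m) (y ^+ k).
    by move=> mk; rewrite /y -expRM_natl -mk mulrC mulrA; exact: evals_pow.
  apply: evalsD; first by apply: evalsZ => //; apply: (yE _ 1%N); field.
  by apply: evalsD; apply: evalsZ => //; [apply: (yE _ 3%N)|apply: (yE _ 6%N)]; field.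
have jen z : (W z - 1) ^+ 4 <= B 4%N z - 4 * B 3%N z + 6 * B 2%N z - 4 * W z + 1.
  have -> : W z - 1 = \sum_i p i * (e i z - 1).
    transitivity (W z - \sum_i p i); first by rewrite p1.
    by rewrite -sumrB; apply: eq_bigr => i _; ring.
  apply: le_trans (jensen_pow4 _ p0 p1) _.
  rewrite le_eqVlt; apply/orP; left; apply/eqP.
  transitivity (B 4%N z - 4 * B 3%N z + 6 * B 2%N z - 4 * W z + \sum_i p i);
    last by rewrite p1.
  rewrite /B /W !mulr_sumr -sumrB -big_split/= -sumrB -big_split/=.
  by apply: eq_bigr => i _; ring.
have tay z := frac_taylor b0 (W0 z) eta0 (jen z).
pose h := (2 * eta)^-1.
have hE m : m / eta = 2 * h * m by rewrite /h; field; rewrite gt_eqF.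
have b1i : 0 <= (1 + b)^-1 by rewrite invr_ge0 ltW.
have e2 : 0 <= eta / 2 by rewrite divr_ge0// ltW.
have {}h0 : 0 <= h by [].
have h4 : 0 <= h * 4 by rewrite mulr_ge0.
have h6 : 0 <= h * 6 by rewrite mulr_ge0.
have c22 : 0 <= 2 * c2 by rewrite mulr_ge0.
have le_P : r + (c1 + c2 + ((eta + h * 4) * 1 +
      (c2 * Q + (0 * y + (h * 4 * y ^+ 3 + 0 * y ^+ 6))))) <=
    (1 + b)^-1 + eta / 2 + h + ((c1 + 2 * c2) * 1 +
      (eta / 2 * Q + (h * 6 * y + (0 * y ^+ 3 + h * y ^+ 6)))).
  apply: (evals_le _ _ _ _ (evalsD rE (evalsP _ _ _ _ _ _ _ _ _ _ _ _))
    (evalsP _ _ _ _ _ _ _ _ _ _ _ _)); rewrite ?addr_ge0 ?e2 ?b1i ?h4 ?h6 ?c22 ?(ltW eta0)//.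
  move=> z; have := tay z; rewrite -sigmoidE -/c1 -/c2 hE ler_norml => /andP[_].
  by rewrite /P; lra.
have ge_P : (1 + b)^-1 + ((c1 + 2 * c2 + eta + h * 4) * 1 +
      (0 * Q + (0 * y + (h * 4 * y ^+ 3 + 0 * y ^+ 6)))) <=
    r + (c1 + c2 + eta / 2 + h + (0 * 1 +
      ((c2 + eta / 2) * Q + (h * 6 * y + (0 * y ^+ 3 + h * y ^+ 6))))).
  apply: (evals_le _ _ _ _ (evalsP _ _ _ _ _ _ _ _ _ _ _ _)
    (evalsD rE (evalsP _ _ _ _ _ _ _ _ _ _ _ _))); rewrite ?addr_ge0 ?e2 ?b1i ?h4 ?h6 ?c22 ?(ltW eta0)//.
  move=> z; have := tay z; rewrite -sigmoidE -/c1 -/c2 hE ler_norml => /andP[+ _].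
  by rewrite /P; lra.
by rewrite hE ler_norml /M; apply/andP; split; lra.
Qed.

End step.
End SoftMax.

(** * Comparison of two Gaussian processes with equal variances *)

Section Compare.
Context {R : realType} {K : nat}.
Local Notation S := (K.-tuple (measurableTypeR R)).
Variables (beta v : R) (lX lY : seq ('I_K -> R)).
Hypotheses (K0 : (0 < K)%N).
Hypothesis varX : forall i, \sum_(a <- lX) a i ^+ 2 = v.
Hypothesis varY : forall i, \sum_(a <- lY) a i ^+ 2 = v.
Hypothesis covXY : forall i j,
  \sum_(a <- lY) a i * a j <= \sum_(a <- lX) a i * a j.

Let f (z : S) := (sigmoid beta z)%:E.

(** Each process contributes one half: its error term, with [Q] replaced by the upper bound [y] that
    corresponds to the covariance v. *)
Let defect (tau eta : R) : R :=
  let y := expR (tau ^+ 2 * beta ^+ 2 * v) in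
  eta * (y - 1) + (y ^+ 6 - 4 * y ^+ 3 + 6 * y - 3) / eta.

Let defect_ge0 tau eta : 0 < eta -> 0 <= defect tau eta.
Proof.
move=> eta0.
have v0 : 0 <= v by rewrite -(varX (Ordinal K0)) sumr_ge0// => a _; exact: sqr_ge0.
rewrite /defect; set y := expR _.
have y1 : 1 <= y by rewrite -[leLHS]expR0 ler_expR; do 2 apply: mulr_ge0 => //; exact: sqr_ge0.
apply: addr_ge0; first by rewrite mulr_ge0 ?subr_ge0// ltW.
apply: divr_ge0; last exact: ltW.
(* The double root at y = 1 gives the sign here, and later makes this term of order tau^4. *)
have -> : y ^+ 6 - 4 * y ^+ 3 + 6 * y - 3 =
  (y - 1) ^+ 2 * (y ^+ 4 + 2 * y ^+ 3 + 3 * (y ^+ 2 - 1)) by ring.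
have y0 : 0 <= y by exact: expR_ge0.
have y2 : 0 <= y ^+ 2 - 1 by rewrite subr_ge0 exprn_ege1.
apply: mulr_ge0; first exact: sqr_ge0.
apply: addr_ge0; last exact: mulr_ge0.
by apply: addr_ge0; [exact: exprn_ge0|apply: mulr_ge0 => //; exact: exprn_ge0].
Qed.

(** The coefficient of [Q - 1] in the expansion is negative, and larger covariances mean a larger
    [Q]. *)
Let gsmear_sigmoid_step tau eta x : 0 < tau -> 0 < eta ->
  (gsmear tau lX f x <= gsmear tau lY f x + (defect tau eta)%:E)%E.
Proof.
move=> tau0 eta0.
have [rX [-> hX]] := gsmear_sigmoid_approx beta x tau0 K0 varX eta0.
have [rY [-> hY]] := gsmear_sigmoid_approx beta x tau0 K0 varY eta0.
rewrite -EFinD lee_fin; move: hX hY; rewrite /defect.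
set b := (_ * _)^-1; set y := expR (_ * v); set M := _ - 3.
set p := fun i => expR (beta * tnth x i) / sumexp beta x.
set QX := \sum_i \sum_j _; set QY := \sum_i \sum_j _.
have Z0 : 0 < sumexp beta x.
  by rewrite /sumexp (bigD1 (Ordinal K0))//= ltr_pwDl ?expR_gt0// sumr_ge0// => i _; exact: expR_ge0.
have p0 i : 0 <= p i by rewrite divr_ge0 ?expR_ge0 ?ltW.
have p1 : \sum_i p i = 1 by rewrite -mulr_suml divff// gt_eqF.
have tb0 : 0 <= tau ^+ 2 * beta ^+ 2 by rewrite mulr_ge0 ?sqr_ge0.
have QYX : QY <= QX.
  apply: ler_sum => i _; apply: ler_sum => j _.
  apply: ler_wpM2l; first exact: mulr_ge0 (p0 i) (p0 j).
  by rewrite ler_expR ler_wpM2l.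
have QXy : QX <= y.
  have -> : y = \sum_i \sum_j p i * p j * y.
    under eq_bigr do under eq_bigr do rewrite -mulrA.
    under eq_bigr do rewrite -mulr_sumr -mulr_suml p1 mul1r.
    by rewrite -mulr_suml p1 mul1r.
  apply: ler_sum => i _; apply: ler_sum => j _.
  apply: ler_wpM2l; first exact: mulr_ge0 (p0 i) (p0 j).
  rewrite ler_expR ler_wpM2l//.
  have -> : v = \sum_(a <- lX) (a i ^+ 2 + a j ^+ 2) / 2.
    by rewrite -mulr_suml big_split/= !varX; field.
  apply: ler_sum => a _; rewrite ler_pdivlMr// -subr_ge0.
  by rewrite (_ : _ - _ = (a i - a j) ^+ 2) ?sqr_ge0//; ring.
have b0 : 0 < b by rewrite invr_gt0 mulr_gt0 ?expR_gt0.
have c0 : 0 <= b / (1 + b) ^+ 3 by rewrite divr_ge0 ?exprn_ge0 ?addr_ge0 ?ltW.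
set c := b / _ in c0 *; set d := (1 + b)^-1; set Me := M / eta.
have cQ : c * QY <= c * QX by rewrite ler_wpM2l.
have eQ : eta * QX <= eta * y by rewrite ler_pM2l.
have eQY : eta * QY <= eta * y by rewrite ler_pM2l// (le_trans QYX).
rewrite !ler_norml => /andP[_ hX] /andP[hY _].
move: hX hY; rewrite -/Me => hX hY.
lra.
Qed.

(* The averaging operators commute, so that one-step errors add up over [n] steps. *)
Let gsmear_sigmoid_iter tau eta n x : 0 < tau -> 0 < eta ->
  (iter n (gsmear tau lX) f x <=
   iter n (gsmear tau lY) f x + (n%:R * defect tau eta)%:E)%E.
Proof.
move=> tau0 eta0; have d0 := defect_ge0 tau eta0.
have ff : nnm f by exact: nnm_sigmoid.
have nX j g : nnm g -> nnm (iter j (gsmear tau lX) g).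
  by move=> gg; apply: iter_nnm => // h; exact: gsmear_nnm.
have nY j g : nnm g -> nnm (iter j (gsmear tau lY) g).
  by move=> gg; apply: iter_nnm => // h; exact: gsmear_nnm.
have XY j g : nnm g -> gsmear tau lX (iter j (gsmear tau lY) g) =
    iter j (gsmear tau lY) (gsmear tau lX g).
  move=> gg; elim: j => //= j <-; rewrite gsmearC//; exact: nY.
have cY j c : 0 <= c -> iter j (gsmear tau lY) (fun=> c%:E) = fun=> c%:E.
  by move=> c0; elim: j => //= j ->; rewrite gsmear_cst.
have DY j g c : 0 <= c -> nnm g ->
    iter j (gsmear tau lY) (fun z => g z + c%:E)%E =
    (fun z => iter j (gsmear tau lY) g z + c%:E)%E.
  move=> c0 gg; elim: j => //= j ->.
  by rewrite gsmearD ?gsmear_cst//; (exact: nY || exact: nnm_cst).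
have leY j g h : nnm g -> nnm h -> (forall z, g z <= h z)%E ->
    forall z, (iter j (gsmear tau lY) g z <= iter j (gsmear tau lY) h z)%E.
  by move=> gg hh gh; elim: j => //= j IH; apply: gsmear_le => //; exact: nY.
elim: n x => [|n IH] x /=; first by rewrite mul0r adde0.
have nd0 : 0 <= n%:R * defect tau eta by rewrite mulr_ge0.
have nn : nnm (fun z => iter n (gsmear tau lY) f z + (n%:R * defect tau eta)%:E)%E.
  by apply: nnmD; [exact: nY|exact: nnm_cst].
apply: le_trans (gsmear_le tau lX (nX n _ ff) nn IH x) _.
rewrite gsmearD ?gsmear_cst//; last exact: nY.
rewrite XY// -natr1 mulrDl mul1r EFinD [X in (_ <= _ + X)%E]addeC addeA.
apply: leeD2r; rewrite -iterS iterSr.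
apply: le_trans (leY n _ _ _ _ (fun z => gsmear_sigmoid_step z tau0 eta0) x) _.
- exact: gsmear_nnm.
- by apply: nnmD; [exact: gsmear_nnm|exact: nnm_cst].
by rewrite DY//; exact: gsmear_nnm.
Qed.

(** With [eta] = n^(-1/2), y - 1 of order 1/n and the fourth moment term of order 1/n^2, both parts
    of [defect] are of order n^(-3/2); n of them leave O(n^(-1/2)). *)
Let defect_le (n : nat) sigma : (0 < n)%N ->
  2 * (sigma ^+ 2 * beta ^+ 2 * v) <= n%:R ->
  n%:R * defect (sigma / Num.sqrt n%:R) (Num.sqrt n%:R)^-1 <=
  (2 * (sigma ^+ 2 * beta ^+ 2 * v) + 176 * (sigma ^+ 2 * beta ^+ 2 * v) ^+ 2)
    / Num.sqrt n%:R.
Proof.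
set V := _ * v => n0 Vn; set r := Num.sqrt n%:R.
have nR0 : 0 < n%:R :> R by rewrite ltr0n.
have r0 : 0 < r by rewrite sqrtr_gt0.
have r2 : r ^+ 2 = n%:R by rewrite sqr_sqrtr// ltW.
have v0 : 0 <= v by rewrite -(varX (Ordinal K0)) sumr_ge0// => a _; exact: sqr_ge0.
have V0 : 0 <= V by do 2 apply: mulr_ge0 => //; exact: sqr_ge0.
rewrite /defect.
have -> : (sigma / r) ^+ 2 * beta ^+ 2 * v = V / n%:R.
  by rewrite /V -r2; field; rewrite gt_eqF.
set u := V / n%:R; set y := expR u.
have u0 : 0 <= u by rewrite divr_ge0// ltW.
have u1 : u <= 2^-1.
  by rewrite ler_pdivrMr// mulrC ler_pdivlMr// mulrC.
have y1 : 1 <= y by rewrite -[leLHS]expR0 ler_expR.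
have yu : y * (1 - u) <= 1.
  have := expR_ge1Dx (- u); rewrite -(ler_pM2l (expR_gt0 u)) -expRD subrr expR0.
  by [].
have y2 : y <= 2 by nra.
have yu2 : y - 1 <= 2 * u by nra.
(* For y in [1, 2] this is at most 16 + 16 + 9. Together with (y - 1)^2 <= 4 u^2 the rounded value
   44 yields the constant 176. *)
have p44 : y ^+ 4 + 2 * y ^+ 3 + 3 * (y ^+ 2 - 1) <= 44.
  have y0 : 0 <= y by rewrite (le_trans ler01).
  have yk k : y ^+ k <= 2 ^+ k by rewrite lerXn2r ?nnegrE.
  have h2 := yk 2%N; have h3 := yk 3%N; have h4 := yk 4%N.
  lra.
have pu : y ^+ 6 - 4 * y ^+ 3 + 6 * y - 3 <= 176 * u ^+ 2.
  have -> : y ^+ 6 - 4 * y ^+ 3 + 6 * y - 3 =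
    (y - 1) ^+ 2 * (y ^+ 4 + 2 * y ^+ 3 + 3 * (y ^+ 2 - 1)) by ring.
  have yu4 : (y - 1) ^+ 2 <= 4 * u ^+ 2.
    have -> : 4 * u ^+ 2 = (2 * u) ^+ 2 by ring.
    by apply: lerXn2r; rewrite ?nnegrE ?subr_ge0//; exact: mulr_ge0.
  apply: (@le_trans _ _ ((y - 1) ^+ 2 * 44)); first by rewrite ler_wpM2l ?sqr_ge0.
  by apply: (@le_trans _ _ (4 * u ^+ 2 * 44)); [rewrite ler_wpM2r|lra].
have un : u = V / r ^+ 2 by rewrite r2.
rewrite invrK -r2.
apply: (@le_trans _ _ (r ^+ 2 * (r^-1 * (2 * u) + 176 * u ^+ 2 * r))).
  rewrite ler_wpM2l ?sqr_ge0// lerD//.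
    by rewrite ler_wpM2l// invr_ge0 ltW.
  by rewrite ler_wpM2r// ltW.
rewrite le_eqVlt; apply/orP; left; apply/eqP; rewrite un; field.
by rewrite gt_eqF.
Qed.

Lemma gsmear_sigmoid_le sigma x : 0 < sigma ->
  (gsmear sigma lX f x <= gsmear sigma lY f x)%E.
Proof.
move=> s0.
have ff : nnm f by exact: nnm_sigmoid.
have fin l : exists r : R, gsmear sigma l f x = r%:E.
  exists (fine (gsmear sigma l f x)).
  have ge0 := (gsmear_nnm sigma l ff).2 x.
  rewrite fineK// ge0_fin_numE// (@le_lt_trans _ _ 1%:E) ?ltry//.
  have := gsmear_le sigma l ff (nnm_cst S (@ler01 R))
    (fun z => sigmoid_le1 beta z) x.
  by rewrite gsmear_cst.
set C := 2 * (sigma ^+ 2 * beta ^+ 2 * v) + 176 * (sigma ^+ 2 * beta ^+ 2 * v) ^+ 2.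
have le_C n : 2 * (sigma ^+ 2 * beta ^+ 2 * v) <= n.+1%:R ->
    (gsmear sigma lX f x <= gsmear sigma lY f x + (C / Num.sqrt n.+1%:R)%:E)%E.
  move=> Vn.
  have r0 : 0 < Num.sqrt n.+1%:R :> R by rewrite sqrtr_gt0.
  have t0 : 0 < sigma / Num.sqrt n.+1%:R by rewrite divr_gt0.
  have e0 : 0 < (Num.sqrt n.+1%:R)^-1 :> R by rewrite invr_gt0.
  have := gsmear_sigmoid_iter n.+1 x t0 e0.
  rewrite !iter_gsmear// mulrC divfK ?gt_eqF// => /le_trans; apply.
  by rewrite leeD2l// lee_fin defect_le.
move: le_C; have [rX ->] := fin lX; have [rY ->] := fin lY => le_C.
rewrite lee_fin; apply/ler_addgt0Pr => e e0.
(* N is large enough both for the hypothesis of [le_C] and for C / sqrt (N + 1) <= e. *)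
set N := Num.bound (`|2 * (sigma ^+ 2 * beta ^+ 2 * v)| + (C / e) ^+ 2).
have HN : `|2 * (sigma ^+ 2 * beta ^+ 2 * v)| + (C / e) ^+ 2 < N%:R.
  by apply: archi_boundP; apply: addr_ge0 => //; exact: sqr_ge0.
have HN1 : N%:R <= N.+1%:R :> R by rewrite ler_nat.
have V0 := ler_norm (2 * (sigma ^+ 2 * beta ^+ 2 * v)).
have := le_C N; rewrite -EFinD lee_fin => /(_ _)/le_trans; apply.
  by apply: le_trans V0 _; have := sqr_ge0 (C / e); lra.
rewrite lerD2l ler_pdivrMr ?sqrtr_gt0// mulrC -ler_pdivrMr//.
apply: le_trans (ler_norm _) _; rewrite -sqrtr_sqr ler_sqrt//.
by have := normr_ge0 (2 * (sigma ^+ 2 * beta ^+ 2 * v)); lra.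
Qed.

End Compare.

(** * From sigmoids to exponentials of a smoothed maximum *)

Section LogSumExp.
Context {R : realType} {K : nat}.
Local Notation mu := (@lebesgue_measure R).
Local Notation S := (K.-tuple (measurableTypeR R)).
Variables (lam beta : R).
Hypotheses (K0 : (0 < K)%N) (lam0 : 0 < lam) (lambeta : lam < beta).

Let beta0 : 0 < beta. Proof. exact: lt_trans lambeta. Qed.

(** The offsets [w] are zero in the comparison; they collect the quadratic terms left behind when
    Gaussian directions are integrated out one by one. *)
Definition logsumexp (w : 'I_K -> R) (z : S) : R :=
  ln (\sum_i expR (beta * (tnth z i + w i))) / beta.

Let sum_gt0 (y : 'I_K -> R) : 0 < \sum_i expR (y i).
Proof.
by rewrite (bigD1 (Ordinal K0))//= ltr_pwDl ?expR_gt0// sumr_ge0// => i _; exact: expR_ge0.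
Qed.

Lemma ge_logsumexp w z i : tnth z i + w i <= logsumexp w z.
Proof.
rewrite ler_pdivlMr// mulrC -[leLHS]expRK ler_ln ?posrE ?expR_gt0//.
by rewrite (bigD1 i)//= lerDl sumr_ge0// => j _; exact: expR_ge0.
Qed.

Lemma logsumexp_le w w' z z' c :
  (forall i, tnth z i + w i <= tnth z' i + w' i + c) ->
  logsumexp w z <= logsumexp w' z' + c.
Proof.
move=> le_c; rewrite /logsumexp -(mulfK (lt0r_neq0 beta0) c) -mulrDl.
rewrite ler_pM2r ?invr_gt0// -[X in _ + X]expRK -lnM ?posrE ?expR_gt0//.
rewrite ler_ln ?posrE ?mulr_gt0 ?expR_gt0// mulr_suml; apply: ler_sum => i _.
by rewrite -expRD ler_expR [c * _]mulrC -mulrDr ler_pM2l.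
Qed.

Lemma measurable_logsumexp w : measurable_fun setT (logsumexp w).
Proof.
apply: measurable_funM => //; apply: measurableT_comp; first exact: measurable_ln.
apply: measurable_sum => i; apply: measurableT_comp; first exact: measurable_expR.
apply: measurable_funM => //; apply: measurable_funD => //.
exact: (@measurable_tnth _ (measurableTypeR R)).
Qed.

Definition explse w (z : S) : \bar R := (expR (lam * logsumexp w z))%:E.

Lemma nnm_explse w : nnm (explse w).
Proof.
split=> [|z]; last by rewrite lee_fin expR_ge0.
apply/measurable_EFinP; apply: measurableT_comp; first exact: measurable_expR.
by apply: measurable_funM => //; exact: measurable_logsumexp.
Qed.

Let expl (r : R) := expR (lam * r).

Let weight_expl : weight expl.
Proof.
split=> [|t]; last exact: expR_ge0.
by apply: measurableT_comp; [exact: measurable_expR|exact: measurable_funM].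
Qed.

Let h (r : R) := (1 + expR (beta * r))^-1.

Let h0 r : 0 <= h r. Proof. by rewrite invr_ge0 addr_ge0 ?expR_ge0. Qed.

Let measurable_h : measurable_fun setT h.
Proof.
rewrite (_ : h = fun r => expR (- ln (1 + expR (beta * r)))); last first.
  by apply/funext => r; rewrite expRN lnK// posrE addr_gt0 ?expR_gt0.
apply: measurableT_comp => //; apply: measurable_funN.
apply: measurableT_comp; first exact: measurable_ln.
apply: measurable_funD => //; apply: measurableT_comp => //; exact: measurable_funM.
Qed.

Let C : \bar R := (\int[mu]_r (expl r * h r)%:E)%E.

Let measurable_explh : measurable_fun [set: R] (fun r => (expl r * h r)%:E).
Proof.
by apply/measurable_EFinP; apply: measurable_funM => //; exact: weight_expl.1.
Qed.

Let C_gt0 : (0 < C)%E.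
Proof.
have c0 : 0 < (1 + expR beta)^-1 by rewrite invr_gt0 addr_gt0 ?expR_gt0.
apply: (@lt_le_trans _ _ ((1 + expR beta)^-1)%:E); first by rewrite lte_fin.
have -> : ((1 + expR beta)^-1)%:E =
    (\int[mu]_r ((1 + expR beta)^-1%:E * (\1_`[0, 1] r)%:E))%E.
  rewrite ge0_integralZl//.
    by rewrite integral_indic//= setIT lebesgue_measure_itv/= lte_fin ltr01 oppr0 adde0 mule1.
  by apply/measurable_EFinP; exact: measurable_indic.
apply: ge0_le_integral => //.
- by apply/measurable_EFinP; apply: measurable_funM => //; exact: measurable_indic.
- move=> r _; rewrite -EFinM lee_fin indicE.
  have [|_] := boolP (r \in _); last by rewrite mulr0 mulr_ge0// ?expR_ge0 ?h0.
  rewrite inE/= in_itv/= => /andP[r0 r1]; rewrite mulr1.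
  rewrite -[leLHS]mul1r ler_pM ?(ltW c0)//.
    by rewrite -expR0 ler_expR mulr_ge0// ltW.
  rewrite lef_pV2 ?posrE ?addr_gt0 ?expR_gt0// lerD2l ler_expR.
  by rewrite ger_pMr.
Qed.

(** The integrand decays at rate lam at minus infinity and at rate beta - lam at plus infinity, so
    two exponential densities dominate it; this uses lam < beta. *)
Let C_fin : (C < +oo)%E.
Proof.
pose m := beta - lam; have m0 : 0 < m by rewrite subr_gt0.
have mp (r : R) : measurable_fun [set: R] (fun t => (exponential_pdf r t)%:E).
  by apply/measurable_EFinP; exact: measurable_exponential_pdf.
have mpN : measurable_fun [set: R] (fun t => (exponential_pdf lam (- t))%:E).
  apply: (@measurableT_comp _ _ _ _ _ _ (fun t => (exponential_pdf lam t)%:E)) => //.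
apply: (@le_lt_trans _ _ (\int[mu]_r ((lam^-1)%:E * (exponential_pdf lam (- r)%R)%:E
  + (m^-1)%:E * (exponential_pdf m r)%:E))%E).
  apply: ge0_le_integral => //.
  - by move=> r _; rewrite lee_fin mulr_ge0 ?expR_ge0.
  - by apply: emeasurable_funD; apply: emeasurable_funM => //; exact: mp.
  - move=> r _; rewrite -!EFinM -EFinD lee_fin.
    have p1 : 0 <= lam^-1 * exponential_pdf lam (- r).
      by rewrite mulr_ge0 ?exponential_pdf_ge0 ?invr_ge0 ?ltW.
    have p2 : 0 <= m^-1 * exponential_pdf m r.
      by rewrite mulr_ge0 ?exponential_pdf_ge0 ?invr_ge0 ?ltW.
    have [r0|r0] := leP 0 r.
      apply: (@le_trans _ _ (m^-1 * exponential_pdf m r)); last by rewrite lerDr.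
      rewrite exponential_pdfE// mulKf ?gt_eqF//.
      rewrite ler_pdivrMr ?addr_gt0 ?expR_gt0// mulrDr mulr1 -expRD.
      by rewrite (_ : - m * r + beta * r = lam * r) ?lerDr ?expR_ge0// /m; ring.
    apply: (@le_trans _ _ (lam^-1 * exponential_pdf lam (- r))); last by rewrite lerDl.
    rewrite exponential_pdfE; last by rewrite oppr_ge0 ltW.
    rewrite mulKf ?gt_eqF// mulrNN.
    by rewrite -[leRHS]mulr1 ler_wpM2l ?expR_ge0// invf_le1 ?addr_gt0 ?expR_gt0// lerDl expR_ge0.
have pge r t : 0 < r -> (0 <= (exponential_pdf r t)%:E)%E.
  by move=> r0; rewrite lee_fin exponential_pdf_ge0// ltW.
have l0 : (0 <= (lam^-1)%:E)%E by rewrite lee_fin invr_ge0 ltW.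
have m0' : (0 <= (m^-1)%:E)%E by rewrite lee_fin invr_ge0 ltW.
rewrite ge0_integralD//; last 4 first.
- by move=> t _; rewrite mule_ge0// pge.
- by apply: emeasurable_funM => //; exact: mpN.
- by move=> t _; rewrite mule_ge0// pge.
- by apply: emeasurable_funM => //; exact: mp.
have -> : (\int[mu]_t ((lam^-1)%:E * (exponential_pdf lam (- t)%R)%:E) = (lam^-1)%:E)%E.
  rewrite ge0_integralZl//; last by move=> t _; rewrite pge.
  rewrite (ge0_integral_opp (mp lam)) ?integral_exponential_pdf ?mule1//.
  by move=> t; rewrite pge.
rewrite ge0_integralZl//; last 2 first.
- exact: mp.
- by move=> t _; rewrite pge.
by rewrite integral_exponential_pdf// mule1 -EFinD ltry.
Qed.

Let w0 : 'I_K -> R := fun=> 0.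

(* Averaging the sigmoid of [z - r] against [expR (lam * r)] turns it into a
   multiple of the power [lam / beta] of [sumexp], which tends to the
   exponential of the maximum as [beta] grows. *)
Let smear_sigmoid z :
  smear expl (fun=> -1) (fun y => (sigmoid beta y)%:E) z = (C * explse w0 z)%E.
Proof.
set m := logsumexp w0 z.
have Zm : sumexp beta z = expR (beta * m).
  rewrite /m /logsumexp mulrCA divff ?gt_eqF// mulr1 lnK ?posrE//.
  by apply: eq_bigr => i _; rewrite addr0.
have sE r : sigmoid beta (transl z (fun=> -1) r) = h (r - m).
  have -> : sigmoid beta (transl z (fun=> -1) r) =
      expR (beta * m - beta * r) / (expR (beta * m - beta * r) + 1).
    rewrite /sigmoid (_ : sumexp beta _ = expR (beta * m - beta * r))//.
    rewrite expRD -Zm /sumexp mulr_suml; apply: eq_bigr => i _.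
    by rewrite tnth_transl -expRD; congr expR; ring.
  rewrite /h -[beta * m - _]opprK expRN.
  rewrite (_ : - (beta * m - beta * r) = beta * (r - m)); last by ring.
  have e0 : 0 < expR (beta * (r - m)) by exact: expR_gt0.
  by field; rewrite !gt_eqF// addr_gt0.
have mF : measurable_fun [set: R] (fun r => (expl r * h (r - m))%:E).
  apply/measurable_EFinP; apply: measurable_funM; first exact: weight_expl.1.
  apply: measurableT_comp => //; exact: measurable_funB.
rewrite /smear; under eq_integral do rewrite -EFinM sE.
rewrite -(ge0_integral_shift m mF); last first.
  by move=> r; rewrite lee_fin mulr_ge0 ?expR_ge0.
rewrite /explse -/m muleC /C -ge0_integralZl//=.
- apply: eq_integral => r _; rewrite -EFinM; congr (_%:E).
  by rewrite addrK mulrA /expl mulrDr expRD [X in _ = X * _]mulrC.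
- by move=> r _; rewrite lee_fin mulr_ge0 ?expR_ge0.
Qed.

(** The average over shifts turns the sigmoid into [C] times [explse] and commutes with [gsmear];
    [C] is positive and finite, so it cancels. *)
Lemma gsmear_explse_le sigma v (lX lY : seq ('I_K -> R)) x : 0 < sigma ->
  (forall i, \sum_(a <- lX) a i ^+ 2 = v) ->
  (forall i, \sum_(a <- lY) a i ^+ 2 = v) ->
  (forall i j, \sum_(a <- lY) a i * a j <= \sum_(a <- lX) a i * a j) ->
  (gsmear sigma lX (explse w0) x <= gsmear sigma lY (explse w0) x)%E.
Proof.
move=> s0 vX vY cXY.
have C1 : C \is a fin_num by rewrite ge0_fin_numE ?(ltW C_gt0).
have C0 : 0 < fine C by rewrite -lte_fin fineK.
pose f (z : S) := (sigmoid beta z)%:E.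
have ff : nnm f by exact: nnm_sigmoid.
have E l z : gsmear sigma l (smear expl (fun=> -1) f) z =
    ((fine C)%:E * gsmear sigma l (explse w0) z)%E.
  rewrite (_ : smear expl _ _ = fun z => ((fine C)%:E * explse w0 z)%E).
    by rewrite gsmearZ ?(ltW C0)//; exact: nnm_explse.
  by apply/funext => y; rewrite smear_sigmoid fineK.
rewrite -(@lee_pmul2l _ (fine C)%:E) ?lte_fin// -!E -!smear_gsmear//.
apply: smear_le => //; [exact: gsmear_nnm|exact: gsmear_nnm|move=> y].
exact: (gsmear_sigmoid_le _ K0 vX vY cXY).
Qed.

(** A shift of all coordinates by t adds exactly t to [logsumexp], which leaves the exponential
    moment of a single Gaussian. *)
Lemma smear_explse_cst sigma x : 0 < sigma ->
  smear (gauss sigma) (fun=> 1) (explse w0) x =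
  ((expR (sigma ^+ 2 * lam ^+ 2 / 2))%:E * explse w0 x)%E.
Proof.
move=> s0.
have tE t : logsumexp w0 (transl x (fun=> 1) t) = logsumexp w0 x + t.
  apply/eqP; rewrite eq_le -lerBrDr; apply/andP; split.
    by apply: logsumexp_le => i; rewrite tnth_transl; lra.
  by apply: logsumexp_le => i; rewrite tnth_transl; lra.
have -> : smear (gauss sigma) (fun=> 1) (explse w0) x =
    (\int[mu]_t ((gauss sigma t * expR (lam * t))%:E * explse w0 x))%E.
  apply: eq_integral => t _; rewrite EFinM -muleA; congr (_ * _)%E.
  by rewrite /explse tE -EFinM -expRD mulrDr addrC.
rewrite -gauss_mgf//; apply: ge0_integralZr => //.
- apply/measurable_EFinP; apply: measurable_funM; first exact: (weight_gauss sigma).1.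
  by apply: measurableT_comp => //; exact: measurable_funM.
- by move=> t _; rewrite lee_fin mulr_ge0 ?(weight_gauss _).2 ?expR_ge0.
- by rewrite lee_fin expR_ge0.
Qed.

Section chi.
Variables (J : Type) (a : J -> 'I_K -> R) (s : J -> R) (sigma : R).
Hypotheses (sigma0 : 0 < sigma) (s_gt : forall c, lam * sigma ^+ 2 < s c).

(** The average of exp(lam t^2 / (2 s)), with s = [s c], for t of law N(0, sigma^2); it is finite by
    [s_gt]. *)
Let kappa c := (Num.sqrt (1 - lam * sigma ^+ 2 / s c))^-1.

Let s0 c : 0 < s c.
Proof. by apply: le_lt_trans (s_gt c); rewrite mulr_ge0 ?sqr_ge0 ?ltW. Qed.

Let kappa0 c : 0 <= kappa c. Proof. by rewrite invr_ge0. Qed.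

(* [t y <= t^2 / (2 s) + s y^2 / 2] decouples the Gaussian variable from [a c]. *)
Let smear_explse c w x : (smear (gauss sigma) (a c) (explse w) x <=
  (kappa c)%:E * explse (fun i => w i + s c * a c i ^+ 2 / 2)%R x)%E.
Proof.
set w' := fun i => _.
have sc := s0 c.
have cs : 2 * (lam / (2 * s c)) * sigma ^+ 2 = lam * sigma ^+ 2 / s c.
  by field; rewrite gt_eqF.
have cs1 : 2 * (lam / (2 * s c)) * sigma ^+ 2 < 1.
  by rewrite cs ltr_pdivrMr// mul1r.
rewrite /kappa -cs -gauss_sqr_mgf//.
pose G t := ((gauss sigma t)%:E * (expR (lam / (2 * s c) * t ^+ 2))%:E)%E.
have mG : measurable_fun [set: measurableTypeR R] G.
  apply: emeasurable_funM; apply/measurable_EFinP; first exact: (weight_gauss sigma).1.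
  apply: measurableT_comp => //; apply: measurable_funM => //; exact: measurable_funX.
have G0 t : (0 <= G t)%E.
  by rewrite /G -EFinM lee_fin mulr_ge0 ?(weight_gauss _).2 ?expR_ge0.
have -> : (\int[mu]_t ((gauss sigma t)%:E * (expR (lam / (2 * s c) * t ^+ 2))%:E) *
    explse w' x = \int[mu]_t (G t * explse w' x))%E.
  apply/esym; apply: ge0_integralZr => //.
  exact: (nnm_explse w').2.
apply: ge0_le_integral.
- exact: measurableT.
- by move=> t _; rewrite mule_ge0 ?(nnm_explse w).2// lee_fin (weight_gauss _).2.
- exact: (measurable_smear_body1 (a c) x (weight_gauss sigma) (nnm_explse w)).
- by apply: emeasurable_funM.
move=> t _; rewrite /G -muleA lee_wpmul2l ?lee_fin ?(weight_gauss _).2//.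
rewrite -expRD ler_expR.
have -> : lam / (2 * s c) * t ^+ 2 = lam * (t ^+ 2 / (2 * s c)) by field; rewrite gt_eqF.
rewrite -mulrDr ler_pM2l// addrC.
apply: logsumexp_le => i; rewrite tnth_transl /w'.
have : 0 <= (t - s c * a c i) ^+ 2 / (2 * s c) by rewrite divr_ge0 ?sqr_ge0 ?mulr_ge0 ?ltW.
rewrite (_ : _ / _ = t ^+ 2 / (2 * s c) + s c * a c i ^+ 2 / 2 - t * a c i); first by lra.
by field; rewrite gt_eqF.
Qed.

(** Integrating out one direction costs a factor [kappa c] and adds a quadratic term to the offset
    of each i. When the directions are the coordinates of unit vectors, these terms sum to a
    constant and the process has disappeared from the bound. *)
Lemma gsmear_explse_chi (l : seq J) w x :
  (gsmear sigma (map a l) (explse w) x <= (\prod_(c <- l) kappa c)%:E *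
    explse (fun i => w i + \sum_(c <- l) s c * a c i ^+ 2 / 2)%R x)%E.
Proof.
elim: l w x => [|c l IH] w x /=.
  rewrite big_nil mul1e /explse (_ : (fun i => _) = w)//.
  by apply/funext => i; rewrite big_nil addr0.
have p0 : 0 <= \prod_(c <- l) kappa c by rewrite prodr_ge0.
apply: (le_trans (smear_le (a c) x (weight_gauss sigma) _ _ (IH w))).
- by apply: gsmear_nnm; exact: nnm_explse.
- by apply: nnmZ => //; exact: nnm_explse.
rewrite smearZ//; [|exact: weight_gauss|exact: nnm_explse].
apply: (le_trans (lee_wpmul2l _ (smear_explse c _ x))); first by rewrite lee_fin.
have -> : (fun i => w i + \sum_(j <- c :: l) s j * a j i ^+ 2 / 2) =
    (fun i => w i + \sum_(j <- l) s j * a j i ^+ 2 / 2 + s c * a c i ^+ 2 / 2).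
  by apply/funext => i; rewrite big_cons -addrA [in RHS](addrC (\sum_(j <- l) _)).
by rewrite muleA -EFinM big_cons [(\prod_(_ <- _) _ * _)%R]mulrC.
Qed.

End chi.

End LogSumExp.

(** * The exponential moment of the operator norm *)

Section Chevet.
Context {R : realType} {K q n : nat}.
Local Notation S := (K.-tuple (measurableTypeR R)).
Variables (lam sigma : R) (al : 'I_K -> 'I_q -> R) (nu : 'I_K -> 'I_n -> R).
Variable l0 : seq ('I_K -> R).
Hypotheses (K0 : (0 < K)%N) (q0 : (0 < q)%N) (n0 : (0 < n)%N).
Hypotheses (lam0 : 0 < lam) (sigma0 : 0 < sigma).
Hypothesis al1 : forall i, \sum_c al i c ^+ 2 = 1.
Hypothesis nu1 : forall i, \sum_c nu i c ^+ 2 = 1.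
Hypothesis cov0 : forall i j, \sum_(a <- l0) a i * a j =
  (\sum_c al i c * al j c) * (\sum_c nu i c * nu j c).

Let J := ('I_q + 'I_n)%type.

Let a (c : J) (i : 'I_K) : R :=
  match c with inl c => al i c | inr c => nu i c end.

(** This value makes [1 - lam * sigma ^+ 2 / s1 k] the inverse of 1 + lam sigma / sqrt k. By 1 + t
    <= exp t, the norm of a k-dimensional Gaussian vector then costs at most exp(lam sigma sqrt k +
    lam^2 sigma^2 / 2), offset included. *)
Let s1 (k : nat) := sigma * (lam * sigma + Num.sqrt k%:R).

Let s (c : J) : R := match c with inl _ => s1 q | inr _ => s1 n end.

Let sum_le1 k (y z : 'I_k -> R) : \sum_c y c ^+ 2 = 1 -> \sum_c z c ^+ 2 = 1 ->
  \sum_c y c * z c <= 1.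
Proof.
move=> y1 z1; have -> : 1 = \sum_c (y c ^+ 2 + z c ^+ 2) / 2 :> R.
  by rewrite -mulr_suml big_split/= y1 z1; field.
apply: ler_sum => c _; rewrite ler_pdivlMr// -subr_ge0.
by rewrite (_ : _ - _ = (y c - z c) ^+ 2) ?sqr_ge0//; ring.
Qed.

Let sqrt_gt0 k : (0 < k)%N -> 0 < Num.sqrt k%:R :> R.
Proof. by move=> k0; rewrite sqrtr_gt0 ltr0n. Qed.

Let ls0 : 0 < lam * sigma. Proof. exact: mulr_gt0. Qed.

Let s1_gt k : (0 < k)%N -> lam * sigma ^+ 2 < s1 k.
Proof.
move=> k0; rewrite /s1 expr2 mulrA [X in _ < X]mulrC ltr_pM2r// ltrDl.
exact: sqrt_gt0.
Qed.

Let kappa1_le k : (0 < k)%N ->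
  (Num.sqrt (1 - lam * sigma ^+ 2 / s1 k))^-1 ^+ k <=
  expR (lam * sigma * Num.sqrt k%:R / 2).
Proof.
move=> k0; have r0 := sqrt_gt0 k0; set r := Num.sqrt k%:R in r0 *.
have r2 : r ^+ 2 = k%:R by rewrite sqr_sqrtr.
have -> : 1 - lam * sigma ^+ 2 / s1 k = (1 + lam * sigma / r)^-1.
  rewrite /s1 -/r; field.
  by rewrite !gt_eqF// ?addr_gt0// ?divr_gt0// mulr_gt0// addr_gt0.
have -> : lam * sigma * r / 2 = k%:R * (lam * sigma / r / 2).
  by rewrite -r2; field; rewrite gt_eqF.
rewrite expRM_natl; apply: lerXn2r; rewrite ?nnegrE ?expR_ge0 ?invr_ge0//.
rewrite sqrtrV ?invrK; last by rewrite addr_ge0// divr_ge0// ltW.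
rewrite -[leRHS]ger0_norm ?expR_ge0// -sqrtr_sqr ler_sqrt ?exprn_gt0 ?expR_gt0//.
rewrite -expRM_natl (_ : 2 * _ = lam * sigma / r) ?expR_ge1Dx//; field.
by rewrite gt_eqF.
Qed.

(** The maximum is taken of exponentials, not of their exponents, so that the default value 0 of the
    iterated maximum is harmless. *)
Definition expmax (z : S) : \bar R :=
  (\big[Num.max/0]_i expR (lam * tnth z i))%:E.

Lemma nnm_expmax : nnm expmax.
Proof.
split=> [|z]; last first.
  by rewrite lee_fin; elim/big_ind : _ => // x y x0 y0; rewrite le_max x0.
apply/measurable_EFinP.
elim: (index_enum 'I_K) => [|i r IH].
  by rewrite (_ : (fun _ => _) = cst 0)//; apply/funext => z; rewrite big_nil.
rewrite (_ : (fun _ => _) = (fun z : S => Num.max (expR (lam * tnth z i))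
    (\big[Num.max/0]_(j <- r) expR (lam * tnth z j)))).
  apply: measurable_maxr => //; apply: measurableT_comp; first exact: measurable_expR.
  by apply: measurable_funM => //; exact: (@measurable_tnth _ (measurableTypeR R)).
by apply/funext => z; rewrite big_cons.
Qed.

Let x0 : S := [tuple 0 | _ < K].

Lemma gsmear_expmax_le : (gsmear sigma l0 expmax x0 <=
  (expR (lam * sigma * (Num.sqrt n%:R + Num.sqrt q%:R) + lam ^+ 2 * sigma ^+ 2 / 2))%:E)%E.
Proof.
set A := lam * sigma * _ + _.
(* [logsumexp] dominates the maximum, and exceeds it by [ln K%:R / beta] where all coordinates are
   equal; this error vanishes as beta grows. *)
have key beta : lam < beta ->
    (gsmear sigma l0 expmax x0 <= (expR (A + lam * (ln K%:R / beta)))%:E)%E.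
  move=> lb; have b0 : 0 < beta by exact: lt_trans lb.
  (* The independent direction 1 makes the variances of both processes equal to 2;
     the difference of covariances is [(1 - al_i . al_j) * (1 - nu_i . nu_j)]. *)
  pose lX := l0 ++ [:: (fun=> 1) : 'I_K -> R].
  pose lY := map a (index_enum J).
  have covX i j : \sum_(b <- lX) b i * b j =
      (\sum_c al i c * al j c) * (\sum_c nu i c * nu j c) + 1.
    by rewrite big_cat/= cov0 big_seq1 mulr1.
  have covY i j : \sum_(b <- lY) b i * b j =
      \sum_c al i c * al j c + \sum_c nu i c * nu j c.
    by rewrite big_map big_sumType.
  have sqE (r : seq ('I_K -> R)) i : \sum_(b <- r) b i ^+ 2 = \sum_(b <- r) b i * b i.
    by apply: eq_bigr => b _; rewrite expr2.
  have alE i : \sum_c al i c * al i c = 1.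
    by rewrite -(al1 i); apply: eq_bigr => c _; rewrite expr2.
  have nuE i : \sum_c nu i c * nu i c = 1.
    by rewrite -(nu1 i); apply: eq_bigr => c _; rewrite expr2.
  have varX i : \sum_(b <- lX) b i ^+ 2 = 2.
    by rewrite sqE covX alE nuE; ring.
  have varY i : \sum_(b <- lY) b i ^+ 2 = 2.
    by rewrite sqE covY alE nuE; ring.
  have covXY i j : \sum_(b <- lY) b i * b j <= \sum_(b <- lX) b i * b j.
    rewrite covX covY.
    have := sum_le1 (al1 i) (al1 j); have := sum_le1 (nu1 i) (nu1 j).
    nra.
  have := gsmear_explse_le K0 lam0 lb x0 sigma0 varX varY covXY.
  rewrite gsmear_cat/= (_ : smear _ _ _ = fun z =>
    ((expR (sigma ^+ 2 * lam ^+ 2 / 2))%:E * explse lam beta (fun=> 0%R) z)%E); last first.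
    by apply/funext => z; rewrite (smear_explse_cst K0 lam0 lb).
  rewrite gsmearZ ?expR_ge0//; last exact: nnm_explse.
  have sgt c : lam * sigma ^+ 2 < s c by case: c => c; exact: s1_gt.
  move=> /le_trans/(_ (gsmear_explse_chi K0 lam0 lb a sigma0 sgt _ _ _)).
  rewrite big_sumType/= !big_const !card_ord !iter_mulr_1.
  set w := fun i => _ + _.
  (* The offset is the same for all i because [al i] and [nu i] are unit vectors. *)
  have wE i : w i = (s1 q + s1 n) / 2.
    by rewrite /w add0r big_sumType/= -!mulr_suml -!mulr_sumr al1 nu1; field.
  have lE : logsumexp beta w x0 <= (s1 q + s1 n) / 2 + ln K%:R / beta.
    rewrite /logsumexp; under eq_bigr do rewrite wE tnth_mktuple add0r.
    rewrite big_const card_ord iter_addr_0 -[X in ln X]mulr_natr lnM ?posrE ?expR_gt0 ?ltr0n//.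
    by rewrite expRK mulrDl [beta * _]mulrC mulfK ?gt_eqF.
  rewrite -EFinM => H.
  apply: (le_trans (gsmear_le sigma l0 nnm_expmax (nnm_explse lam beta (fun=> 0%R)) _ x0)).
    move=> z; rewrite lee_fin; elim/big_ind : _ => [|y y' hy hy'|i _].
    - exact: expR_ge0.
    - by rewrite ge_max hy.
    rewrite ler_expR ler_pM2l//.
    by have := ge_logsumexp K0 lam0 lb (fun=> 0%R) z i; rewrite addr0.
  (* The factor of the common direction takes up half of the lam^2 sigma^2 in the exponent on the
     other side. *)
  rewrite -(@lee_pmul2l _ (expR (sigma ^+ 2 * lam ^+ 2 / 2))%:E) ?lte_fin ?expR_gt0//.
  apply: (le_trans H); rewrite -EFinM lee_fin -expRD.
  apply: (@le_trans _ _ (expR (lam * sigma * Num.sqrt q%:R / 2) *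
     expR (lam * sigma * Num.sqrt n%:R / 2) *
     expR (lam * ((s1 q + s1 n) / 2 + ln K%:R / beta)))).
    rewrite ler_pM ?mulr_ge0 ?exprn_ge0 ?invr_ge0 ?expR_ge0//.
      by rewrite ler_pM ?exprn_ge0 ?invr_ge0 ?kappa1_le.
    by rewrite ler_expR ler_pM2l.
  by rewrite -!expRD ler_expR /A /s1; lra.
have fin : gsmear sigma l0 expmax x0 \is a fin_num.
  rewrite ge0_fin_numE; last by have [_] := gsmear_nnm sigma l0 nnm_expmax; apply.
  have lb : lam < lam + 1 by rewrite ltrDl.
  exact: le_lt_trans (key _ lb) (ltry _).
move: key; rewrite -(fineK fin); set r := fine _ => key.
rewrite lee_fin; have [r0|r0] := leP r 0; first exact: le_trans r0 (expR_ge0 _).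
rewrite -[leLHS](lnK r0) ler_expR; apply/ler_addgt0Pr => e e0.
pose B := lam * ln K%:R.
have B0 : 0 <= B by rewrite mulr_ge0 ?ln_ge0 ?ler1n// ltW.
(* With beta = lam + 1 + B / e the error B / beta is at most e. *)
have lb : lam < lam + 1 + B / e.
  by rewrite -addrA ltrDl ltr_pwDl// divr_ge0// ltW.
have b0 : 0 < lam + 1 + B / e by exact: lt_trans lb.
have := key _ lb; rewrite lee_fin -[leLHS](lnK r0) ler_expR => /le_trans; apply.
rewrite lerD2l mulrA ler_pdivrMr// -/B mulrDr mulrCA divff ?gt_eqF// mulr1.
by rewrite lerDr mulr_ge0 ?(ltW e0)// addr_ge0 ?(ltW lam0).
Qed.

End Chevet.

(** * Independent normal variables as iterated integrals *)

Section Density.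
Context {R : realType}.
Local Notation mu := (@lebesgue_measure R).

Lemma ge0_integral_normal_prob (s : R) (f : measurableTypeR R -> \bar R) :
  measurable_fun setT f -> (forall x, 0 <= f x)%E ->
  (\int[normal_prob 0 s]_x f x = \int[mu]_x ((gauss s x)%:E * f x))%E.
Proof.
move=> mf f0.
have dom := normal_prob_dominates 0 s.
rewrite -(Radon_Nikodym_SigmaFinite.change_of_variables dom)//.
have mg : measurable_fun [set: measurableTypeR R] (fun x => (gauss s x)%:E).
  by apply/measurable_EFinP; exact: measurable_normal_pdf.
have iRN := Radon_Nikodym_SigmaFinite.f_integrable dom.
under [RHS]eq_integral do rewrite muleC.
apply: ae_eq_integral => //.
- apply: emeasurable_funM => //; exact: (measurable_int mu).
- exact: emeasurable_funM.
apply: ae_eqe_mul2l; apply: integral_ae_eq => //.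
move=> E _ mE; rewrite -Radon_Nikodym_SigmaFinite.f_integral//.
Qed.

End Density.

Section Link.
Context {R : realType} {K : nat} {d : measure_display} {T : measurableType d}.
Local Notation mu := (@lebesgue_measure R).
Local Notation S := (K.-tuple (measurableTypeR R)).
Context {I : finType}.
Variables (Z : I -> {mfun T >-> R}) (sigma : R) (a : I -> 'I_K -> R).

Definition lincomb (l : seq I) (w : T) : S :=
  [tuple \sum_(i <- l) Z i w * a i k | k < K].

(** Independence and the marginal laws in one condition, relative to [P] and [l] because both change
    in the induction below: a variable leaves the list and [P] is conditioned on an event of that
    variable. *)
Definition iid_normal (P : probability T R) (l : seq I) : Prop :=
  forall (J : {set I}) (B : I -> set R),
    {subset J <= l} -> (forall i, measurable (B i)) ->
    P (\bigcap_(i in [set` J]) (Z i @^-1` B i)) =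
    (\prod_(i in J) normal_prob 0 sigma (B i))%E.

Lemma measurable_lincomb l : measurable_fun setT (lincomb l).
Proof.
apply/measurable_fun_tnthP => k.
rewrite (_ : _ \o _ = fun w => \sum_(i <- l) Z i w * a i k); last first.
  by apply/funext => w /=; rewrite tnth_mktuple.
by apply: measurable_sum => i; exact: measurable_funM.
Qed.

Definition addt (x y : S) : S := [tuple tnth x k + tnth y k | k < K].

Lemma measurable_addt x : measurable_fun setT (addt x).
Proof.
apply/measurable_fun_tnthP => k.
rewrite (_ : _ \o _ = fun y => tnth x k + tnth y k); last first.
  by apply/funext => y /=; rewrite tnth_mktuple.
apply: measurable_funD => //; exact: (@measurable_tnth _ (measurableTypeR R)).
Qed.

Lemma integral_lincomb l (P : probability T R) (f : S -> \bar R) x :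
  uniq l -> iid_normal P l -> nnm f ->
  (\int[P]_w f (addt x (lincomb l w)) = gsmear sigma (map a l) f x)%E.
Proof.
elim: l P f x => [|i l IH] P f x /=.
  move=> _ _ [mf f0].
  have xE w : addt x (lincomb [::] w) = x.
    by apply: eq_from_tnth => k; rewrite !tnth_mktuple big_nil addr0.
  under eq_integral do rewrite xE.
  rewrite integral_cst//; transitivity (f x * 1)%E; last by rewrite mule1.
  by congr (_ * _)%E; exact: probability_setT.
move=> /andP[il ul] iid ff.
have iidl : iid_normal P l.
  by move=> J B Jl mB; apply: iid => // j /Jl; rewrite inE orbC => ->.
pose x0 : S := [tuple 0 | _ < K].
pose V := lincomb l.
have mV : measurable_fun setT V by exact: measurable_lincomb.
have x0E y : addt x0 y = y.
  by apply: eq_from_tnth => k; rewrite !tnth_mktuple add0r.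
(* The induction hypothesis determines the law of [V]: all measures that satisfy [iid_normal] on l
   give it the same law. *)
have indicE (Q : probability T R) B : measurable B -> iid_normal Q l ->
    Q (V @^-1` B) = gsmear sigma (map a l) (fun y => (\1_B y)%:E) x0.
  move=> mB iidQ; rewrite -(IH Q)//; last first.
    split=> [|y]; last by rewrite lee_fin.
    by apply/measurable_EFinP; exact: measurable_indic.
  have mVB : measurable (V @^-1` B) by rewrite -[X in measurable X]setTI; exact: mV.
  transitivity (\int[Q]_w (\1_(V @^-1` B) w)%:E)%E.
    by rewrite integral_indic// setIT.
  by apply: eq_integral => w _; rewrite x0E !indicE.
have mZ A : measurable A -> measurable (Z i @^-1` A).
  by move=> mA; rewrite -[X in measurable X]setTI; exact: measurable_funP.
have PZ A : measurable A -> P (Z i @^-1` A) = normal_prob 0 sigma A.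
  move=> mA; have := iid [set i]%SET (fun=> A).
  rewrite big_set1 => <- //.
    congr (P _); apply/seteqP; split=> [w Aw j /=|w]; last by apply; rewrite /= inE.
    by rewrite inE => /eqP ->.
  by move=> j; rewrite !inE => ->.
(* Independence of [Z i] and [V]: under [P] conditioned on [Z i @^-1` A] the
   remaining variables have the same joint law, to which the induction
   hypothesis applies. *)
have rect A B : measurable A -> measurable B ->
    P ((Z i @^-1` A) `&` (V @^-1` B)) = (P (Z i @^-1` A) * P (V @^-1` B))%E.
  move=> mA mB; set C := Z i @^-1` A.
  have mC : measurable C by exact: mZ.
  have mVB : measurable (V @^-1` B) by rewrite -[X in measurable X]setTI; exact: mV.
  have [PC0|PC0] := eqVneq (P C) 0%E.
    rewrite PC0 mul0e; apply/eqP; rewrite -measure_le0 -PC0 le_measure ?inE//.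
    exact: measurableI.
  have PCfin : P C \is a fin_num by exact: fin_num_measure.
  pose P' : probability T R := mnormalize (mrestr P mC) P.
  have P'E U : P' U = (P (U `&` C) * ((fine (P C))^-1)%:E)%E.
    rewrite /P' /= /mnormalize /= /mrestr setTI (negbTE PC0)/=.
    by rewrite lt_eqF// -ge0_fin_numE.
  have PCV : (P C * ((fine (P C))^-1)%:E = 1)%E.
    by rewrite -{1}(fineK PCfin) -EFinM divff// fine_eq0.
  have iid' : iid_normal P' l.
    move=> J B' Jl mB'; rewrite P'E.
    have iJ : i \notin J by apply/negP => /Jl; rewrite (negbTE il).
    pose B'' j := if j == i then A else B' j.
    have mB'' j : measurable (B'' j) by rewrite /B''; case: ifP.
    have := iid (i |: J)%SET B'' _ mB''.
    rewrite big_setU1//= {2}/B'' eqxx => H.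
    rewrite (_ : _ `&` C = \bigcap_(j in [set` (i |: J)%SET]) (Z j @^-1` B'' j)).
      rewrite H; last first.
        by move=> j; rewrite !inE => /orP[->//|/Jl ->]; rewrite orbT.
      rewrite -PZ// -/C muleC muleA (muleC _ (P C)) PCV mul1e.
      apply: eq_bigr => j jJ; rewrite /B''; case: eqP => // ji.
      by rewrite ji (negbTE iJ) in jJ.
    apply/seteqP; split=> [w [Jw Cw] j /=|w Jw].
      rewrite !inE /B''; case: eqP => [->//|_] /= jJ; exact: Jw.
    split=> [j jJ|].
      have := Jw j; rewrite /= !inE jJ orbT /B'' => /(_ isT).
      by case: eqP => // ji; rewrite /= ji (negbTE iJ) in jJ.
    by have := Jw i; rewrite /= !inE eqxx /B'' eqxx => /(_ isT).
  have : P' (V @^-1` B) = P (V @^-1` B) by rewrite !indicE.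
  rewrite P'E => <-.
  by rewrite muleCA PCV mule1 setIC.
pose z (w : T) : measurableTypeR R := Z i w.
have mz : measurable_fun setT z by exact: (measurable_funP (Z i)).
pose Zi : {mfun T >-> measurableTypeR R} :=
  HB.pack z (isMeasurableFun.Build _ _ _ _ z mz).
pose phi w := (z w, V w).
have mphi : measurable_fun setT phi by apply: measurable_fun_pair.
pose VV : {mfun T >-> S} := HB.pack V (isMeasurableFun.Build _ _ _ _ V mV).
pose Phi : {mfun T >-> (measurableTypeR R * S)%type} :=
  HB.pack phi (isMeasurableFun.Build _ _ _ _ phi mphi).
pose F (z : measurableTypeR R * S) := f (addt (transl x (a i) z.1) z.2).
have mF : measurable_fun setT F.
  apply: (measurableT_comp ff.1); apply/measurable_fun_tnthP => k.
  rewrite (_ : _ \o _ = fun z => tnth x k + z.1 * a i k + tnth z.2 k); last first.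
    by apply/funext => y /=; rewrite !tnth_mktuple.
  apply: measurable_funD.
    by apply: measurable_funD => //; exact: measurable_funM.
  apply: (@measurableT_comp _ _ _ _ _ _ (fun y : S => tnth y k)) => //=.
  exact: measurable_tnth.
have F0 y : (0 <= F y)%E by exact: ff.2.
transitivity (\int[distribution P Phi]_z F z)%E.
  rewrite ge0_integral_distribution//; apply: eq_integral => w _ /=.
  rewrite /F /=; congr f; apply: eq_from_tnth => k.
  by rewrite !tnth_mktuple big_cons addrA.
transitivity (\int[distribution P Zi \x distribution P VV]_z F z)%E.
  apply: eq_measure_integral => X mX _; apply/esym.
  apply: product_measure_unique => // A B mA mB; exact: rect.
rewrite fubini_tonelli1//.
transitivity (\int[distribution P Zi]_t gsmear sigma (map a l) f (transl x (a i) t))%E.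
  apply: eq_integral => t _; rewrite /fubini_F -(IH P)//.
  rewrite ge0_integral_distribution//.
  by apply: measurableT_comp => //; exact: measurable_pair1.
have mg : measurable_fun [set: measurableTypeR R]
    (fun t => gsmear sigma (map a l) f (transl x (a i) t)).
  apply: (measurableT_comp (gsmear_nnm sigma (map a l) ff).1).
  exact: (measurable_fun_pair2 x (measurable_transl (a i))).
rewrite /smear -ge0_integral_normal_prob//; last first.
  by move=> t; have [_] := gsmear_nnm sigma (map a l) ff; apply.
apply: eq_measure_integral => A mA _; exact: PZ.
Qed.

End Link.

(** * Linear algebra *)

Section GramSchmidt.
Context {R : rcfType}.

Lemma row_sqr_ge0 n (w : 'rV[R]_n) : 0 <= (w *m w^T) 0 0.
Proof.
by rewrite mxE; apply: sumr_ge0 => i _; rewrite mxE -expr2 sqr_ge0.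
Qed.

Lemma row_sqr_eq0 n (w : 'rV[R]_n) : ((w *m w^T) 0 0 == 0) = (w == 0).
Proof.
apply/eqP/eqP => [/eqP|->]; last by rewrite mul0mx mxE.
rewrite mxE psumr_eq0 => [/allP w0|j _]; last by rewrite mxE -expr2 sqr_ge0.
apply/rowP => i; have := w0 i (mem_index_enum _).
by rewrite !mxE /= -expr2 sqrf_eq0 => /eqP.
Qed.

(** A row of [V] outside the span of [Q], minus its projection onto that span and normalised, is the
    next row. *)
Lemma gram_schmidt_aux r n (V : 'M[R]_(r, n)) k : (k <= \rank V)%N ->
  exists Q : 'M[R]_(k, n), Q *m Q^T = 1%:M /\ (Q <= V)%MS.
Proof.
elim: k => [_|k IH kV].
  by exists 0; split; [apply/matrixP => -[]|exact: sub0mx].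
have [Q [QQ QV]] := IH (ltnW kV).
have rQ : \rank Q = k.
  apply/eqP; apply/row_freeP; exists Q^T; exact: QQ.
have /row_subPn [i iQ] : ~~ (V <= Q)%MS.
  by apply/negP => /mxrankS; rewrite rQ leqNgt kV.
set v := row i V in iQ; pose w := v - v *m Q^T *m Q.
have w0 : w != 0.
  apply: contra iQ; rewrite subr_eq0 => /eqP ->; exact: submxMl.
have wQ : w *m Q^T = 0 by rewrite mulmxBl -!mulmxA QQ mulmx1 subrr.
have wV : (w <= V)%MS.
  by rewrite addmx_sub ?row_sub// eqmx_opp (submx_trans _ QV)// submxMl.
have ww0 : 0 < (w *m w^T) 0 0 by rewrite lt_neqAle eq_sym row_sqr_eq0 w0 row_sqr_ge0.
pose c := (Num.sqrt ((w *m w^T) 0 0))^-1.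
rewrite -addn1; exists (col_mx Q (c *: w)); split; last first.
  by rewrite col_mx_sub QV scalemx_sub.
rewrite tr_col_mx mul_col_row QQ linearZ/= -scalemxAr -!scalemxAl wQ.
rewrite -[Q *m w^T]trmxK trmx_mul trmxK wQ trmx0 -scalemxAr !scaler0 scalerA.
rewrite [w *m _]mx11_scalar scale_scalar_mx [RHS]scalar_mx_block; congr (block_mx _ _ _ _%:M).
by rewrite -expr2 exprVn sqr_sqrtr ?ltW// mulVf// gt_eqF.
Qed.

Lemma gram_schmidt r n (V : 'M[R]_(r, n)) :
  exists Q : 'M[R]_(\rank V, n), Q *m Q^T = 1%:M /\ (Q :=: V)%MS.
Proof.
have [Q [QQ QV]] := gram_schmidt_aux (leqnn (\rank V)).
exists Q; split=> //; apply/eqmxP.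
have rQ : \rank Q = \rank V.
  apply/eqP; apply/row_freeP; exists Q^T; exact: QQ.
by rewrite QV/= -(geq_leqif (mxrank_leqif_sup QV)) rQ.
Qed.

End GramSchmidt.

(** * Spectral decomposition and low rank approximation *)

Section RealSpectral.
Context {R : realType}.

Definition spectrum n (M : 'M[R]_n) : 'rV[R]_n :=
  \row_i complex.Re (spectral_diag (map_mx (real_complex R) M) 0 i).

(** Over R[i] the matrix is diagonalised unitarily with real eigenvalues, and real matrices similar
    over R[i] are similar over R. The descent gives an invertible [S] with no orthogonality;
    [gram_schmidt] supplies it where projections are built. *)
Lemma real_diagonalization n (M : 'M[R]_n) : M^T = M ->
  exists2 S : 'M[R]_n, S \in unitmx & S *m M = diag_mx (spectrum M) *m S.
Proof.
move=> MT; set MC := map_mx (real_complex R) M.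
have realC m p (B : 'M[R]_(m, p)) : map_mx (real_complex R) B \is a mxOver Num.real.
  by apply/mxOverP => i j; rewrite mxE complex_real.
have symC : MC \is symmetricmx.
  by apply/is_hermitianmxP; rewrite expr0 scale1r map_mx_id// map_trmx MT.
have hermC : MC \is hermsymmx by exact: realsym_hermsym symC (realC _ _ _).
have /orthomx_spectralP E := hermitian_normalmx hermC.
have DR := hermitian_spectral_diag_real hermC.
have DE : spectral_diag MC = map_mx (real_complex R) (spectrum M).
  by apply/rowP => i; rewrite !mxE RRe_real//; exact: (mxOverP DR).
have uP := spectral_unit MC.
have simC : exists2 Q, Q \in unitmx &
    similar Q MC (map_mx (real_complex R) (diag_mx (spectrum M))).
  exists (spectralmx MC) => //; apply/similarP => //.
  rewrite [X in _ *m X = _]E !mulmxA mulmxV// mul1mx map_diag_mx.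
  by rewrite DE.
have [Q /andP[QR uQ] /(similarP uQ)] := real_similar simC (realC _ _ _) (realC _ _ _).
have QE : Q = map_mx (real_complex R) (map_mx (@complex.Re R) Q).
  by apply/matrixP => i j; rewrite !mxE RRe_real//; exact: (mxOverP QR).
rewrite QE -!map_mxM => /map_mx_inj H.
exists (map_mx (@complex.Re R) Q) => //.
by rewrite -(map_unitmx (real_complex R)) -QE.
Qed.

(** The selected rows of [S] span a subspace invariant under right multiplication by [M], with
    eigenvalues [D 0 (f i)]. [P] is the orthogonal projection onto it, and the trace of [M *m P] is
    that of the restriction of [M], computed in the basis of eigenvectors. *)
Lemma trace_projection k n (M S : 'M[R]_n) (D : 'rV[R]_n) (f : 'I_k -> 'I_n) :
  S \in unitmx -> S *m M = diag_mx D *m S -> injective f ->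
  exists P : 'M[R]_n, [/\ P^T = P, P *m P = P, (\rank P <= k)%N &
    \tr (M *m P) = \sum_(i < k) D 0 (f i)].
Proof.
move=> uS SM injf.
pose V := rowsub f S; pose U := invmx S *m (rowsub f 1%:M)^T.
have VU : V *m U = 1%:M.
  rewrite /V /U rowsubE mulmxA mulmxK// -rowsubE.
  by apply/matrixP => i j; rewrite !mxE eq_sym (inj_eq injf).
pose Dk := diag_mx (\row_i D 0 (f i)).
have VM : V *m M = Dk *m V.
  rewrite /V rowsubE -mulmxA SM 2!mulmxA -rowsubE; congr (_ *m _).
  apply/matrixP => i j; rewrite mul_diag_mx !mxE; case: eqP => [->|]; last by rewrite mulr0.
  by rewrite mulr1.
have [Q [QQ QV]] := gram_schmidt V.
have /submxP [A QA] : (Q <= V)%MS by rewrite QV.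
have /submxP [B VB] : (V <= Q)%MS by rewrite QV.
have BA : B *m A = 1%:M.
  have BAV : B *m A *m V = V by rewrite -mulmxA -QA -VB.
  by rewrite -[LHS]mulmx1 -VU mulmxA BAV.
exists (Q^T *m Q); split.
- by rewrite trmx_mul trmxK.
- by rewrite mulmxA -(mulmxA Q^T) QQ mulmx1.
- by rewrite (leq_trans (mxrankM_maxr _ _))// QV rank_leq_row.
rewrite mulmxA mxtrace_mulC {1}QA -!mulmxA (mulmxA V) VM -!mulmxA.
rewrite mxtrace_mulC -!mulmxA {1}VB -(mulmxA B) (mulmxA Q) QQ mul1mx BA mulmx1.
by rewrite mxtrace_diag; apply: eq_bigr => i _; rewrite mxE.
Qed.

Definition fsq m n (C : 'M[R]_(m, n)) : R := \tr (C^T *m C).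

Lemma fsqE m n (C : 'M[R]_(m, n)) : fsq C = \sum_i \sum_j C i j ^+ 2.
Proof.
rewrite exchange_big; apply: eq_bigr => j _; rewrite mxE.
by apply: eq_bigr => i _; rewrite mxE expr2.
Qed.

Lemma fsq_ge0 m n (C : 'M[R]_(m, n)) : 0 <= fsq C.
Proof. by rewrite fsqE; do 2!apply: sumr_ge0 => ? _; exact: sqr_ge0. Qed.

Lemma frobenius_norm_sqr m n (C : 'M[R]_(m, n)) : frobenius_norm C ^+ 2 = fsq C.
Proof. by rewrite sqr_sqrtr -fsqE// fsq_ge0. Qed.

Lemma low_rank_approx m n k (C : 'M[R]_(m, n)) : (k <= n)%N ->
  exists P : 'M[R]_n, (\rank P <= k)%N /\
    fsq (C - C *m P) <= \sum_(k.+1 <= j < n.+1) singval C j ^+ 2.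
Proof.
move=> kn; pose M := C^T *m C.
have MT : M^T = M by rewrite trmx_mul trmxK.
have [S uS SM] := real_diagonalization MT.
set D := spectrum M in SM.
pose g i := Num.sqrt (D 0 i).
(* The key is the square root of the eigenvalue, as in [singular_values], so that both sorted lists
   agree position by position. *)
pose s := sort (relpre g >=%R) (enum 'I_n).
have perm_s : perm_eq s (enum 'I_n) by rewrite perm_sort.
have us : uniq s by rewrite sort_uniq enum_uniq.
have ss : size s = n by rewrite size_sort size_enum_ord.
pose f (i : 'I_k) := tnth (Tuple (introT eqP ss)) (widen_ord kn i).
have injf : injective f.
  move=> i j; rewrite /f !(tnth_nth (widen_ord kn i)) => /eqP.
  by rewrite nth_uniq ?ss ?(leq_trans (ltn_ord _))// => /eqP H; apply: val_inj; exact: H.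
pose h i := [seq D 0 j | j <- s]`_i.
have [P [PT PP rP trP]] := trace_projection uS SM injf.
exists P; split=> //.
have trMP1 : \tr ((1%:M - P) *m (M *m (1%:M - P))) = \tr M - \tr (M *m P).
  have PP1 : (1%:M - P) *m (1%:M - P) = 1%:M - P.
    by rewrite mulmxBl mul1mx mulmxBr mulmx1 PP subrr subr0.
  by rewrite mxtrace_mulC -mulmxA PP1 mulmxBr mulmx1 linearB.
have -> : fsq (C - C *m P) = \tr M - \tr (M *m P).
  have -> : C - C *m P = C *m (1%:M - P) by rewrite mulmxBr mulmx1.
  by rewrite -trMP1 /fsq trmx_mul linearB/= trmx1 PT /M !mulmxA.
have -> : \tr M = \sum_(0 <= i < n) h i.
  have -> : \tr M = \tr (S *m M *m invmx S).
    by rewrite [RHS]mxtrace_mulC mulmxA mulVmx// mul1mx.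
  rewrite SM mulmxK// mxtrace_diag -big_enum -(perm_big _ perm_s)/=.
  by rewrite -(big_map (D 0) xpredT id)/= (big_nth 0) size_map ss.
have -> : \tr (M *m P) = \sum_(0 <= i < k) h i.
  rewrite trP big_mkord; apply: eq_bigr => i _.
  have ik : (i < size s)%N by rewrite ss (leq_trans (ltn_ord i)).
  by rewrite /h (nth_map (widen_ord kn i))// /f (tnth_nth (widen_ord kn i)).
rewrite (big_cat_nat _ kn)//= addrAC subrr add0r.
rewrite big_add1 /=; apply: ler_sum_nat => i /andP[_ iln].
have -> : singval C i.+1 = Num.sqrt (h i).
  rewrite /singval /= /singular_values /h -/M.
  rewrite (_ : [seq _ | i <- _] = map g (enum 'I_n)); last first.
    by apply: eq_map => j; rewrite /g mxE.
  rewrite sort_map -/s.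
  rewrite -(nth_map 0 0) ?size_map ?ss// -map_comp.
  by [].
(* For a negative [h i] the square root is 0 and the inequality still holds, so the sign of the
   eigenvalues is left open. *)
have [h0|h0] := leP 0 (h i); first by rewrite sqr_sqrtr.
by rewrite (le_trans (ltW h0)) ?sqr_ge0.
Qed.

End RealSpectral.

(** * Loss bound for a fixed noise matrix *)

Section Oracle.
Context {R : realType}.

Lemma sum_le_sqrt r (x : 'I_r -> R) :
  \sum_i x i <= Num.sqrt r%:R * Num.sqrt (\sum_i x i ^+ 2).
Proof.
have s0 : 0 <= \sum_i x i ^+ 2 by apply: sumr_ge0 => i _; exact: sqr_ge0.
rewrite -sqrtrM// (le_trans (ler_norm _))// -sqrtr_sqr.
rewrite ler_sqrt ?mulr_ge0//.
have : 0 <= \sum_i \sum_j (x i - x j) ^+ 2.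
  by do 2 apply: sumr_ge0 => ? _; exact: sqr_ge0.
have -> : \sum_i \sum_j (x i - x j) ^+ 2 =
    2 * (r%:R * \sum_i x i ^+ 2 - (\sum_i x i) ^+ 2).
  transitivity (\sum_i (r%:R * x i ^+ 2 + \sum_j x j ^+ 2 - 2 * (\sum_j x j) * x i)).
    apply: eq_bigr => i _.
    transitivity (\sum_j (x i ^+ 2 + x j ^+ 2 - 2 * x j * x i)).
      by apply: eq_bigr => j _; ring.
    rewrite sumrB big_split/= sumr_const card_ord -[X in X + _ - _]mulr_natl.
    by rewrite -mulr_suml -mulr_sumr.
  rewrite sumrB big_split/= -!mulr_sumr sumr_const card_ord -[X in _ + X - _]mulr_natl.
  by ring.
by rewrite pmulr_rge0// subr_ge0.
Qed.

(** [D] is any upper bound for the operator norm. The condition is homogeneous in u and v and passes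
    to limits, so rational or unit vectors suffice to test it. *)
Definition opbound q n (G : 'M[R]_(q, n)) (D : R) : Prop :=
  forall (u : 'rV[R]_q) (v : 'rV[R]_n), (u *m G *m v^T) 0 0 <=
    D * Num.sqrt ((u *m u^T) 0 0) * Num.sqrt ((v *m v^T) 0 0).

Lemma mulmx_row_tr r s n (A : 'M[R]_(r, n)) (B : 'M[R]_(s, n)) i j :
  (row i A *m (row j B)^T) 0 0 = (A *m B^T) i j.
Proof. by rewrite !mxE; apply: eq_bigr => k _; rewrite !mxE. Qed.

(** Expansion of [N] in an orthonormal basis of its row space gives [\rank N] terms, each at most D
    times the length of a vector; Cauchy-Schwarz then produces the root of the rank. *)
Lemma trace_le_opbound q n (G N : 'M[R]_(q, n)) D : 0 <= D -> opbound G D ->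
  \tr (G^T *m N) <= D * Num.sqrt (\rank N)%:R * Num.sqrt (fsq N).
Proof.
move=> D0 GD; have [W [WW WN]] := gram_schmidt N.
have /submxP [A NA] : (N <= W)%MS by rewrite WN.
have NE : N *m W^T *m W = N.
  transitivity (A *m W *m W^T *m W); first by rewrite -NA.
  by rewrite -(mulmxA A) WW mulmx1 -NA.
move: (\rank N) W WW {A NA WN} NE => r W WW NE.
pose u l := row l (W *m N^T).
pose x l := Num.sqrt ((u l *m (u l)^T) 0 0).
have trE : \tr (G^T *m N) = \sum_l (u l *m G *m (row l W)^T) 0 0.
  rewrite -[in LHS]NE mulmxA mxtrace_mulC -mxtrace_tr.
  apply: eq_bigr => l _; rewrite /u -row_mul mulmx_row_tr.
  by rewrite !trmx_mul !trmxK.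
have xE : \sum_l x l ^+ 2 = fsq N.
  have -> : fsq N = \tr (N^T *m (N *m W^T *m W)) by rewrite NE.
  rewrite mulmxA mxtrace_mulC.
  apply: eq_bigr => l _; rewrite sqr_sqrtr ?row_sqr_ge0// mulmx_row_tr.
  by rewrite trmx_mul trmxK !mulmxA.
rewrite trE -mulrA -xE.
apply: (@le_trans _ _ (D * \sum_l x l)); last by rewrite ler_wpM2l// sum_le_sqrt.
rewrite mulr_sumr; apply: ler_sum => l _.
have -> : D * x l = D * x l * Num.sqrt ((row l W *m (row l W)^T) 0 0).
  by rewrite mulmx_row_tr WW mxE eqxx sqrtr1 mulr1.
exact: GD.
Qed.

Lemma fsq_le_weighted m n (U V : 'M[R]_(m, n)) a e : 0 < a -> 0 < e ->
  fsq (U - V) <= (a + e) * (fsq U / a + fsq V / e).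
Proof.
move=> a0 e0; rewrite !fsqE !mulr_suml -big_split/= mulr_sumr.
apply: ler_sum => i _; rewrite !mulr_suml -big_split/= mulr_sumr.
apply: ler_sum => j _; rewrite !mxE; set u := U i j; set v := V i j.
rewrite -subr_ge0.
have -> : (a + e) * (u ^+ 2 / a + v ^+ 2 / e) - (u - v) ^+ 2 =
  (e * u + a * v) ^+ 2 / (a * e) by field; rewrite !gt_eqF.
by rewrite divr_ge0 ?sqr_ge0// mulr_ge0// ltW.
Qed.

Lemma fsqB m n (U V : 'M[R]_(m, n)) :
  fsq (U - V) = fsq U - 2 * \tr (U^T *m V) + fsq V.
Proof.
have -> : fsq (U - V) = \tr (U^T *m U - U^T *m V - (V^T *m U - V^T *m V)).
  by rewrite /fsq -!mulmxBr -mulmxBl -[U^T - _]linearB.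
rewrite !linearB/=.
have -> : \tr (V^T *m U) = \tr (U^T *m V) by rewrite -mxtrace_tr trmx_mul trmxK.
ring.
Qed.

Lemma fsqN m n (U : 'M[R]_(m, n)) : fsq (- U) = fsq U.
Proof.
by rewrite !fsqE; apply: eq_bigr => i _; apply: eq_bigr => j _; rewrite mxE sqrrN.
Qed.

(** Optimality bounds |U|^2 - |V|^2 by the difference of penalties plus 2 <E, U - V>. AM-GM with
    weight 1 + theta splits the inner product, and leaves |U - V|^2 / (1 + theta) to be shared
    between U and V. *)
Lemma oracle_inequality m n p q (X : 'M[R]_(m, p)) (A Ah B : 'M[R]_(p, n))
    (E : 'M[R]_(m, n)) (Q : 'M[R]_(q, m)) (mu theta D : R)
    (c := 1 + 2 / theta) :
  0 < theta -> 0 <= D -> Q *m Q^T = 1%:M -> Q^T *m Q *m X = X ->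
  opbound (Q *m E) D ->
  fsq (X *m A + E - X *m Ah) + mu * (\rank Ah)%:R <=
    fsq (X *m A + E - X *m B) + mu * (\rank B)%:R ->
  fsq (X *m Ah - X *m A) <= c ^+ 2 * fsq (X *m A - X *m B)
    + c * (mu * ((\rank B)%:R - (\rank Ah)%:R)
           + (1 + theta) * D ^+ 2 * ((\rank Ah)%:R + (\rank B)%:R)).
Proof.
move=> t0 D0 QQ QX GD opt.
set U := X *m Ah - X *m A; set V := X *m B - X *m A.
have VE : fsq (X *m A - X *m B) = fsq V.
  by rewrite -(fsqN V) opprB.
have UE : X *m A + E - X *m Ah = E - U by rewrite /U opprB addrA [E + _]addrC.
have VE' : X *m A + E - X *m B = E - V by rewrite /V opprB addrA [E + _]addrC.
move: opt; rewrite VE UE VE' (fsqB E U) (fsqB E V) => opt.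
(* The columns of [U - V] lie in the column space of [X], so only the projected noise [Q *m E] acts
   on it. *)
pose N := Q *m (U - V).
have UV : U - V = X *m (Ah - B) by rewrite /U /V mulmxBr opprB addrA subrK.
have QUV : Q^T *m N = U - V by rewrite /N mulmxA UV mulmxA QX.
have NE : fsq N = fsq (U - V).
  have NN : N^T *m N = (U - V)^T *m (Q^T *m N) by rewrite {1}/N trmx_mul mulmxA.
  by rewrite /fsq NN QUV.
have rN : (\rank N)%:R <= (\rank Ah)%:R + (\rank B)%:R :> R.
  rewrite -natrD ler_nat /N UV (leq_trans (mxrankM_maxr _ _))//.
  rewrite (leq_trans (mxrankM_maxr _ _))// (leq_trans (mxrank_add _ _))//.
  by rewrite mxrank_opp.
have := trace_le_opbound N D0 GD.
rewrite trmx_mul -mulmxA QUV NE mulmxBr linearB/= => trle.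
set s := (\rank Ah)%:R + (\rank B)%:R in rN *.
have t1 : 0 < 1 + theta by rewrite addr_gt0.
set y := Num.sqrt (fsq (U - V)) in trle.
have y2 : y ^+ 2 = fsq (U - V) by rewrite sqr_sqrtr// fsq_ge0.
set r := Num.sqrt _ in trle.
have r2 : r ^+ 2 <= s by rewrite sqr_sqrtr.
have amgm : 2 * (D * r * y) <= (1 + theta) * D ^+ 2 * s + y ^+ 2 / (1 + theta).
  apply: (@le_trans _ _ ((1 + theta) * D ^+ 2 * r ^+ 2 + y ^+ 2 / (1 + theta))); last first.
    by rewrite lerD2r ler_wpM2l// mulr_ge0 ?sqr_ge0// ltW.
  rewrite -subr_ge0 (_ : _ - _ = ((1 + theta) * D * r - y) ^+ 2 / (1 + theta)).
    by rewrite divr_ge0 ?sqr_ge0// ltW.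
  by field; rewrite gt_eqF.
(* The two weights add up to 1 + theta, which cancels; this leaves 1 - 1 / (1 + theta / 2) = 1 / c
   on U and 1 + 2 / theta = c on V. *)
have a0 : 0 < 1 + theta / 2 by rewrite addr_gt0// divr_gt0.
have e0 : 0 < theta / 2 by rewrite divr_gt0.
have := fsq_le_weighted U V a0 e0.
have -> : 1 + theta / 2 + theta / 2 = 1 + theta by field.
rewrite -y2 mulrC -ler_pdivrMr// => yle.
have c0 : 0 < c by rewrite addr_gt0// divr_gt0.
set fU := fsq U in opt yle *; set fV := fsq V in opt yle *.
have main : fU - fU / (1 + theta / 2) <= fV + fV / (theta / 2)
  + (mu * ((\rank B)%:R - (\rank Ah)%:R) + (1 + theta) * D ^+ 2 * s).
  lra.
have -> : fU = c * (fU - fU / (1 + theta / 2)).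
  by rewrite /c; field; rewrite !gt_eqF//; lra.
have -> : c ^+ 2 * fV = c * (fV + fV / (theta / 2)).
  by rewrite /c; field; rewrite gt_eqF.
by rewrite -mulrDr ler_pM2l.
Qed.

End Oracle.

(** * The oracle inequality *)

Section Scalar.
Context {R : realType}.

Lemma expR_ge_quadratic (t : R) : 0 <= t -> 1 + t + t ^+ 2 / 4 <= expR t.
Proof.
move=> t0; have -> : expR t = expR (t / 2) ^+ 2.
  by rewrite -expRM_natl; congr expR; field.
have -> : 1 + t + t ^+ 2 / 4 = (1 + t / 2) ^+ 2 by field.
by apply: lerXn2r; rewrite ?nnegrE ?expR_ge0 ?expR_ge1Dx// addr_ge0// divr_ge0.
Qed.

(** D^2 - tau^2 = 2 tau (D - tau) + (D - tau)^2 is matched term by term with 1 + t + t^2 / 4 at t =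
    lam (D - tau), whence the two lower bounds on [k] in [excess]. The last inequality is what
    remains after averaging exp(lam D). *)
Lemma excess_le_expR (sigma xi s : R) : 0 < sigma -> 0 < xi -> 2 <= s ->
  let tau := (1 + xi) * s * sigma in
  exists lam k : R, [/\ 0 < lam, 0 < k,
    forall D, tau <= D -> D ^+ 2 - tau ^+ 2 <= k * expR (lam * (D - tau)) &
    k * expR (- (lam * tau) + (lam * sigma * s + lam ^+ 2 * sigma ^+ 2 / 2)) <=
    2 * sigma ^+ 2 * (1 + xi^-1) * expR (- (xi ^+ 2 * s ^+ 2 / 2))].
Proof.
move=> sig0 xi0 s2 tau.
have s0 : 0 < s by rewrite (lt_le_trans _ s2).
have tau0 : 0 < tau by rewrite !mulr_gt0// addr_gt0.
have excess lam k : 0 < lam -> 2 * tau / lam <= k -> 4 / lam ^+ 2 <= k ->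
    forall D, tau <= D -> D ^+ 2 - tau ^+ 2 <= k * expR (lam * (D - tau)).
  move=> lam0 k1 k2 D tD; have y0 : 0 <= D - tau by rewrite subr_ge0.
  have k0 : 0 <= k by rewrite (le_trans _ k1)// divr_ge0 ?(ltW lam0)// mulr_ge0// ltW.
  set y := D - tau in y0 *.
  have -> : D ^+ 2 - tau ^+ 2 = 2 * tau / lam * (lam * y) + 4 / lam ^+ 2 * ((lam * y) ^+ 2 / 4).
    by rewrite /y; field; rewrite gt_eqF.
  have ly0 : 0 <= lam * y by rewrite mulr_ge0// ltW.
  have h := expR_ge_quadratic ly0.
  apply: (@le_trans _ _ (k * (lam * y) + k * ((lam * y) ^+ 2 / 4))).
    by apply: lerD; apply: ler_wpM2r => //; rewrite divr_ge0// sqr_ge0.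
  by rewrite -mulrDr ler_wpM2l//; lra.
pose b := xi * s; have b0 : 0 < b by rewrite mulr_gt0.
(* [lam = b / sigma] minimises the exponent, but for [b < 1] it would make [k]
   too large. *)
have [b1|b1] := leP 1 b.
  (* In both cases [k] is exactly 2 tau / lam, and 2 <= s makes it at least 4 / lam^2. *)
  exists (b / sigma), (2 * sigma ^+ 2 * (1 + xi^-1)).
  have lam0 : 0 < b / sigma by rewrite divr_gt0.
  have k0 : 0 < 2 * sigma ^+ 2 * (1 + xi^-1).
    by rewrite mulr_gt0 ?addr_gt0 ?invr_gt0// mulr_gt0 ?exprn_gt0.
  split=> //.
    apply: excess => //.
      rewrite le_eqVlt; apply/orP; left; apply/eqP; rewrite /tau /b; field.
      by rewrite !gt_eqF.
    rewrite expr_div_n invf_div mulrA ler_pdivrMr ?exprn_gt0//.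
    have -> : 2 * sigma ^+ 2 * (1 + xi^-1) * b ^+ 2 =
        2 * sigma ^+ 2 * (b ^+ 2 + b * s) by rewrite /b; field; rewrite gt_eqF.
    have bs : 2 <= b ^+ 2 + b * s by nra.
    have sg : 0 <= sigma ^+ 2 by rewrite sqr_ge0.
    nra.
  rewrite ler_wpM2l ?(ltW k0)// ler_expR le_eqVlt; apply/orP; left; apply/eqP.
  by rewrite /tau /b; field; rewrite gt_eqF.
exists sigma^-1, (2 * (1 + xi) * s * sigma ^+ 2).
have lam0 : 0 < sigma^-1 by rewrite invr_gt0.
have k0 : 0 < 2 * (1 + xi) * s * sigma ^+ 2.
  by rewrite mulr_gt0 ?exprn_gt0// mulr_gt0// mulr_gt0 ?addr_gt0.
split=> //.
  apply: excess => //.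
    rewrite le_eqVlt; apply/orP; left; apply/eqP; rewrite /tau; field.
    by rewrite !gt_eqF.
  rewrite exprVn invrK ler_wpM2r ?sqr_ge0//.
  have : 0 <= xi * s by rewrite ltW.
  lra.
have -> : - (sigma^-1 * tau) + (sigma^-1 * sigma * s + sigma^-1 ^+ 2 * sigma ^+ 2 / 2) =
    2^-1 - b by rewrite /tau /b; field; rewrite gt_eqF.
have -> : - (xi ^+ 2 * s ^+ 2 / 2) = - (b ^+ 2 / 2) by rewrite /b exprMn.
have -> : 2 * sigma ^+ 2 * (1 + xi^-1) = 2 * (1 + xi) * s * sigma ^+ 2 * b^-1.
  by rewrite /b; field; rewrite !gt_eqF.
rewrite -[leRHS]mulrA ler_wpM2l ?(ltW k0)// mulrC ler_pdivlMr// mulrC.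
(* It yields b exp(1/2 - b) <= exp(-1/2) <= exp(-b^2 / 2), the latter because b < 1. *)
have bexp : b <= expR (b - 1) by have := expR_ge1Dx (b - 1); lra.
apply: le_trans (ler_wpM2r (expR_ge0 _) bexp) _.
by rewrite -expRD ler_expR; nra.
Qed.

End Scalar.

(** * Reduction of the operator norm to countably many linear forms *)

Section Dense.
Context {R : realType}.

Lemma rat_seq_cvg (x : R) : exists s : nat -> rat, ratr (s k) @[k --> \oo] --> x.
Proof.
have : forall k : nat, exists r : rat, x < ratr r < x + k.+1%:R^-1.
  move=> k; have [|r] := @rat_in_itvoo R x (x + k.+1%:R^-1); first by rewrite ltrDl invr_gt0.
  by rewrite in_itv/=; exists r.
move=> /choice[s sE]; exists s.
apply: (@squeeze_cvgr _ _ _ _ (fun=> x) (fun k => x + k.+1%:R^-1)).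
- by apply: nearW => k; have /andP[/ltW -> /ltW ->] := sE k.
- exact: cvg_cst.
- rewrite -[X in _ --> X]addr0; apply: cvgD; first exact: cvg_cst.
  exact: cvg_harmonic.
Qed.

Lemma cvg_sumr (I : Type) (l : seq I) (f : I -> nat -> R) (g : I -> R) :
  (forall i, f i k @[k --> \oo] --> g i) ->
  \sum_(i <- l) f i k @[k --> \oo] --> \sum_(i <- l) g i.
Proof.
move=> fg; elim: l => [|i l IH].
  by under eq_cvg do rewrite big_nil; rewrite big_nil; exact: cvg_cst.
by under eq_cvg do rewrite big_cons; rewrite big_cons; exact: cvgD.
Qed.

Lemma opbound_dense q n (G : 'M[R]_(q, n)) D :
  (forall (a : 'rV[rat]_q) (b : 'rV[rat]_n),
    (map_mx ratr a *m G *m (map_mx ratr b)^T) 0 0 <=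
    D * Num.sqrt ((map_mx ratr a *m (map_mx ratr a)^T) 0 0 : R)
      * Num.sqrt ((map_mx ratr b *m (map_mx ratr b)^T) 0 0)) ->
  opbound G D.
Proof.
move=> ratD u v.
have /choice[a aE] : forall i, exists s : nat -> rat, ratr (s k) @[k --> \oo] --> u 0 i.
  by move=> i; exact: rat_seq_cvg.
have /choice[b bE] : forall i, exists s : nat -> rat, ratr (s k) @[k --> \oo] --> v 0 i.
  by move=> i; exact: rat_seq_cvg.
pose A k : 'rV[R]_q := map_mx ratr (\row_i a i k).
pose B k : 'rV[R]_n := map_mx ratr (\row_i b i k).
have AE i : A k 0 i @[k --> \oo] --> u 0 i.
  by under eq_cvg do rewrite /A !mxE; exact: aE.
have BE i : B k 0 i @[k --> \oo] --> v 0 i.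
  by under eq_cvg do rewrite /B !mxE; exact: bE.
have sqr_cvg p (W : nat -> 'rV[R]_p) (w : 'rV[R]_p) :
    (forall i, W k 0 i @[k --> \oo] --> w 0 i) ->
    Num.sqrt ((W k *m (W k)^T) 0 0) @[k --> \oo] --> Num.sqrt ((w *m w^T) 0 0).
  move=> WE.
  have H : (W k *m (W k)^T) 0 0 @[k --> \oo] --> (w *m w^T) 0 0.
    have E (x : 'rV[R]_p) : (x *m x^T) 0 0 = \sum_i x 0 i * x 0 i.
      by rewrite mxE; apply: eq_bigr => i _; rewrite mxE.
    under eq_cvg do rewrite E.
    by rewrite E; apply: cvg_sumr => i; apply: cvgM; exact: WE.
  exact: (cvg_comp _ _ H (@sqrt_continuous R _)).
have E (x : 'rV[R]_q) (y : 'rV[R]_n) :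
    (x *m G *m y^T) 0 0 = \sum_j (\sum_i x 0 i * G i j) * y 0 j.
  by rewrite mxE; apply: eq_bigr => j _; rewrite !mxE.
have lhs_cvg : (A k *m G *m (B k)^T) 0 0 @[k --> \oo] --> (u *m G *m v^T) 0 0.
  under eq_cvg do rewrite E.
  rewrite E; apply: cvg_sumr => j; apply: cvgM; last exact: BE.
  by apply: cvg_sumr => i; apply: cvgM; [exact: AE|exact: cvg_cst].
have rhs_cvg : D * Num.sqrt ((A k *m (A k)^T) 0 0) * Num.sqrt ((B k *m (B k)^T) 0 0)
    @[k --> \oo] --> D * Num.sqrt ((u *m u^T) 0 0) * Num.sqrt ((v *m v^T) 0 0).
  apply: cvgM; last exact: sqr_cvg.
  by apply: cvgM; [exact: cvg_cst|exact: sqr_cvg].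
by apply: (ler_cvg_to lhs_cvg rhs_cvg); apply: nearW => k; exact: ratD.
Qed.

End Dense.

Section UnitRows.
Context {R : realType}.

(** A zero row is replaced by a basis vector, so that every index of the enumeration below gives a
    unit vector. *)
Definition unit_row r (i0 : 'I_r) (x : 'rV[R]_r) : 'rV[R]_r :=
  if (x *m x^T) 0 0 == 0 then delta_mx 0 i0
  else (Num.sqrt ((x *m x^T) 0 0))^-1 *: x.

Lemma unit_row_norm r (i0 : 'I_r) x :
  (unit_row i0 x *m (unit_row i0 x)^T) 0 0 = 1.
Proof.
rewrite /unit_row; case: ifPn => [_|x0].
  by rewrite trmx_delta mul_delta_mx mxE !eqxx.
rewrite linearZ/= -scalemxAl -scalemxAr scalerA mxE -invfM -expr2.
by rewrite sqr_sqrtr ?row_sqr_ge0// mulVf.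
Qed.

Lemma unit_rowE r (i0 : 'I_r) x :
  x = Num.sqrt ((x *m x^T) 0 0) *: unit_row i0 x.
Proof.
rewrite /unit_row; case: ifPn => [x0|x0].
  by rewrite (eqP x0) sqrtr0 scale0r; apply/eqP; rewrite -row_sqr_eq0.
by rewrite scalerA mulfV ?scale1r// gt_eqF// sqrtr_gt0 lt_neqAle eq_sym x0 row_sqr_ge0.
Qed.

(** Rational vectors are dense, and by homogeneity they may be normalised. A countable family makes
    the supremum a limit of measurable finite maxima. *)
Lemma countable_opbound q n : (0 < q)%N -> (0 < n)%N ->
  exists u : nat -> 'rV[R]_q, exists v : nat -> 'rV[R]_n,
  [/\ forall i, (u i *m (u i)^T) 0 0 = 1, forall i, (v i *m (v i)^T) 0 0 = 1 &
      forall (G : 'M[R]_(q, n)) D,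
        (forall i, (u i *m G *m (v i)^T) 0 0 <= D) -> opbound G D].
Proof.
move=> q0 n0; pose i0 := Ordinal q0; pose j0 := Ordinal n0.
(* Numbers that encode no pair are sent to (0, 0), which [unit_row] turns into basis vectors. *)
pose c i : 'rV[rat]_q * 'rV[rat]_n := odflt (0, 0) (unpickle i).
exists (fun i => unit_row i0 (map_mx ratr (c i).1)).
exists (fun i => unit_row j0 (map_mx ratr (c i).2)).
split=> [i|i|G D GD]; [exact: unit_row_norm|exact: unit_row_norm|].
apply: opbound_dense => a b; have := GD (pickle (a, b)).
rewrite /c pickleK/=; set a' : 'rV[R]_q := map_mx _ a; set b' : 'rV[R]_n := map_mx _ b.
rewrite {2}(unit_rowE i0 a') {2}(unit_rowE j0 b').
rewrite [(_ *: unit_row j0 b')^T]linearZ/= -!scalemxAl -scalemxAr scalerA.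
set x := Num.sqrt _; set y := Num.sqrt _ => H.
have xy : 0 <= x * y by rewrite mulr_ge0// sqrtr_ge0.
rewrite -mulrA [D * _]mulrC; apply: le_trans (ler_wpM2l xy H).
by rewrite mxE mulrC [x * y]mulrC mulrC.
Qed.

Lemma opbound_ge0 q n (G : 'M[R]_(q, n)) D : (0 < q)%N -> (0 < n)%N ->
  opbound G D -> 0 <= D.
Proof.
move=> q0 n0 GD; pose u : 'rV[R]_q := delta_mx 0 (Ordinal q0).
pose v : 'rV[R]_n := delta_mx 0 (Ordinal n0).
have nu : (u *m u^T) 0 0 = 1 by rewrite trmx_delta mul_delta_mx mxE !eqxx.
have nv : (v *m v^T) 0 0 = 1 by rewrite trmx_delta mul_delta_mx mxE !eqxx.
have N : (- u *m G *m v^T) 0 0 = - (u *m G *m v^T) 0 0 by rewrite !mulNmx mxE.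
have nN : (- u *m (- u)^T) 0 0 = 1 by rewrite linearN/= mulmxN mulNmx opprK.
have := GD (- u) v; have := GD u v.
by rewrite N nN nu nv sqrtr1 !mulr1; lra.
Qed.

End UnitRows.

(** * The supremum over the countable family as a random variable *)

Section Supremum.
Context {R : realType} {d : measure_display} {T : measurableType d}.
Variables (P : probability T R) (m n q : nat) (Q : 'M[R]_(q, m)).
Variables (Z : 'I_m * 'I_n -> {mfun T >-> R}) (lam sigma : R).
Hypotheses (q0 : (0 < q)%N) (n0 : (0 < n)%N) (QQ : Q *m Q^T = 1%:M).
Hypotheses (lam0 : 0 < lam) (sigma0 : 0 < sigma).
Hypothesis iidZ : iid_normal Z sigma P (enum {: 'I_m * 'I_n}).

Let M w : 'M[R]_(m, n) := \matrix_(i, j) Z (i, j) w.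

Let A := lam * sigma * (Num.sqrt n%:R + Num.sqrt q%:R) + lam ^+ 2 * sigma ^+ 2 / 2.

Section Finite.
Variables (u : nat -> 'rV[R]_q) (v : nat -> 'rV[R]_n).
Hypothesis u1 : forall i, (u i *m (u i)^T) 0 0 = 1.
Hypothesis v1 : forall i, (v i *m (v i)^T) 0 0 = 1.

Definition expform i w := expR (lam * (u i *m (Q *m M w) *m (v i)^T) 0 0).

Definition maxexpform k w := (\big[Num.max/0]_(i < k.+1) expform i w)%:E.

(** The coefficients of the noise entries in the form u_i Q M v_i^T. As the rows of [Q] are
    orthonormal, the covariance of two such forms is the product of inner products that
    [gsmear_expmax_le] asks for. *)
Let a k (c : 'I_m * 'I_n) (i : 'I_k.+1) := (u i *m Q) 0 c.1 * v i 0 c.2.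

Lemma maxexpformE k : maxexpform k =
  expmax lam \o addt [tuple 0 | _ < k.+1] \o lincomb Z (@a k) (enum {: 'I_m * 'I_n}).
Proof.
apply/funext => w /=; congr (_%:E); apply: eq_bigr => i _; congr (expR (_ * _)).
rewrite !tnth_mktuple add0r big_enum/= mulmxA mxE.
transitivity (\sum_x \sum_y Z (x, y) w * a (x, y) i).
  rewrite exchange_big/=.
  apply: eq_bigr => j _; rewrite mxE mulr_suml; apply: eq_bigr => c _.
  by rewrite [M w _ _]mxE [(v i)^T _ _]mxE [RHS]mulrA [Z _ _ * _]mulrC.
by rewrite pair_bigA; apply: eq_bigr => -[].
Qed.

Lemma measurable_maxexpform k : measurable_fun setT (maxexpform k).
Proof.
rewrite maxexpformE; apply: measurableT_comp; last exact: measurable_lincomb.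
by apply: measurableT_comp; [exact: (nnm_expmax _).1|exact: measurable_addt].
Qed.

Lemma integral_maxexpform k : (\int[P]_w maxexpform k w <= (expR A)%:E)%E.
Proof.
rewrite maxexpformE (integral_lincomb _ _ (enum_uniq _) iidZ (nnm_expmax _)).
apply: (@gsmear_expmax_le _ _ _ _ _ _ (fun i c => u i 0 c) (fun i c => v i 0 c)) => //.
- by move=> i; rewrite -[RHS](u1 i) mxE; apply: eq_bigr => c _; rewrite mxE expr2.
- by move=> i; rewrite -[RHS](v1 i) mxE; apply: eq_bigr => c _; rewrite mxE expr2.
move=> i j; rewrite big_map big_enum/=.
transitivity (\sum_x \sum_y a (x, y) i * a (x, y) j).
  by rewrite pair_bigA; apply: eq_bigr => -[].
have uQ : \sum_c (u i *m Q) 0 c * (u j *m Q) 0 c = \sum_c u i 0 c * u j 0 c.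
  transitivity ((u i *m Q *m (u j *m Q)^T) 0 0).
    by rewrite [RHS]mxE; apply: eq_bigr => c _; rewrite [(_ ^T) _ _]mxE.
  rewrite trmx_mul mulmxA -(mulmxA (u i)) QQ mulmx1 mxE.
  by apply: eq_bigr => c _; rewrite mxE.
rewrite -uQ mulr_suml; apply: eq_bigr => x _; rewrite mulr_sumr.
by apply: eq_bigr => y _; rewrite /a/= mulrACA.
Qed.

Lemma maxexpform_ge0 k w : (0 <= maxexpform k w)%E.
Proof. by rewrite maxexpformE /=; apply: (nnm_expmax _).2. Qed.

Lemma nondecreasing_maxexpform w : nondecreasing_seq (maxexpform ^~ w).
Proof.
apply/nondecreasing_seqP => k.
rewrite /maxexpform lee_fin; apply: bigmax_le => [|i _].
  by apply: bigmax_sup (expR_ge0 _) => //; exact: ord0.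
exact: (le_bigmax 0 (fun i : 'I_k.+2 => expform i w) (widen_ord (leqnSn _) i)).
Qed.

Lemma expform_le_max i w : ((expform i w)%:E <= maxexpform i w)%E.
Proof. 
rewrite /maxexpform lee_fin.
exact: (le_bigmax 0 (fun j : 'I_i.+1 => expform j w) ord_max).
Qed.

End Finite.

Lemma integrable_exp_opbound : exists Psi : T -> \bar R,
  [/\ measurable_fun setT Psi, forall w, (0 <= Psi w)%E,
      (\int[P]_w Psi w <= (expR A)%:E)%E &
      forall w, Psi w = +oo%E \/
        exists D, opbound (Q *m M w) D /\ Psi w = (expR (lam * D))%:E].
Proof.
have [u [v [u1 v1 uv]]] := @countable_opbound R _ _ q0 n0.
pose F := maxexpform u v.
have ndF w : nondecreasing_seq (F ^~ w) by exact: nondecreasing_maxexpform.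
have mF k : measurable_fun setT (F k) by exact: measurable_maxexpform.
have F0 k w : (0 <= F k w)%E by exact: maxexpform_ge0.
pose Psi w := limn (F ^~ w).
have cvgF w : F ^~ w @ \oo --> Psi w by exact: ereal_nondecreasing_is_cvgn.
have FPsi k w : (F k w <= Psi w)%E.
  rewrite /Psi (cvg_lim _ (ereal_nondecreasing_cvgn (ndF w)))//.
  by apply: ereal_sup_ubound; exists k.
exists Psi; split=> [|w||w].
- by apply: (@emeasurable_fun_cvg _ _ _ setT F Psi mF) => w _; exact: cvgF.
- exact: le_trans (F0 0 w) (FPsi 0 w).
- rewrite (monotone_convergence P measurableT mF (fun k w _ => F0 k w) (fun w _ => ndF w)).
  apply: lime_le; last by apply: nearW => k; exact: integral_maxexpform.
  apply: ereal_nondecreasing_is_cvgn => i j ij.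
  by apply: ge0_le_integral => // w _; exact: ndF.
case PsiE : (Psi w) => [y||]; [right|by left|]; last first.
  by have := le_trans (F0 0 w) (FPsi 0 w); rewrite PsiE.
have gy i : expform u v i w <= y.
  by rewrite -lee_fin -PsiE; apply: le_trans (FPsi i w); exact: expform_le_max.
have y0 : 0 < y by apply: lt_le_trans (gy 0); exact: expR_gt0.
have yE : expR (lam * (ln y / lam)) = y.
  by rewrite mulrC divfK ?lnK ?posrE// gt_eqF.
exists (ln y / lam); rewrite yE; split=> //; apply: uv => i.
by rewrite -(ler_pM2l lam0) -ler_expR yE; exact: gy.
Qed.

End Supremum.

Lemma le_min_upto (R : realType) N (f : nat -> R) x : (0 < N)%N ->
  (forall k, (0 < k <= N)%N -> x <= f k) -> x <= min_upto N f.
Proof.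
move=> N0 xf; rewrite /min_upto big_nat.
elim/big_ind : _ => [|y z xy xz|k kN]; first by rewrite xf.
  by rewrite le_min xy.
exact: xf.
Qed.

(** * The loss, its excess and its moments *)

Section LossBounds.
Context {R : realType} {m n p : nat} (X : 'M[R]_(m, p)) (A : 'M[R]_(p, n)).

Lemma loss_le_excess (q : nat) (Ah : 'M[R]_(p, n)) (E : 'M[R]_(m, n))
    (Q : 'M[R]_(q, m)) (tau theta D : R) (c := 1 + 2 / theta)
    (mu := (1 + theta) * tau ^+ 2) (N := minn n p) k :
  0 < theta -> 0 <= D -> Q *m Q^T = 1%:M -> Q^T *m Q *m X = X ->
  opbound (Q *m E) D ->
  (forall B, fsq (X *m A + E - X *m Ah) + mu * (\rank Ah)%:R <=
    fsq (X *m A + E - X *m B) + mu * (\rank B)%:R) -> (k <= N)%N ->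
  fsq (X *m Ah - X *m A) <=
    c ^+ 2 * \sum_(k.+1 <= j < n.+1) singval (X *m A) j ^+ 2 + 2 * c * mu * k%:R
    + 2 * c * (1 + theta) * N%:R * Num.max 0 (D ^+ 2 - tau ^+ 2).
Proof.
move=> t0 D0 QQ QX GD opt kN.
have kn : (k <= n)%N by rewrite (leq_trans kN)// geq_minl.
have [P [rP PE]] := low_rank_approx (X *m A) kn.
have c0 : 0 < c by rewrite addr_gt0// divr_gt0.
have := oracle_inequality t0 D0 QQ QX GD (opt (A *m P)); rewrite -/c.
set e := Num.max _ _; set rB := (\rank (A *m P))%:R; set rA := (\rank Ah)%:R.
have e0 : 0 <= e by rewrite le_max lexx.
have eD : D ^+ 2 <= tau ^+ 2 + e by rewrite -lerBlDl le_max lexx orbT.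
have rBk : rB <= k%:R.
  by rewrite ler_nat (leq_trans (mxrankM_maxr _ _)).
have rAN : rA <= N%:R by rewrite ler_nat leq_min rank_leq_col rank_leq_row.
have rBN : rB <= N%:R by rewrite ler_nat leq_min rank_leq_col rank_leq_row.
have rA0 : 0 <= rA by exact: ler0n.
have rB0 : 0 <= rB by exact: ler0n.
move=> /le_trans; apply; rewrite -addrA; apply: lerD.
  by rewrite ler_wpM2l ?sqr_ge0// mulmxA.
have -> : 2 * c * mu * k%:R + 2 * c * (1 + theta) * N%:R * e =
  c * (2 * mu * k%:R + 2 * (1 + theta) * N%:R * e) by ring.
rewrite ler_wpM2l ?(ltW c0)//.
have t1 : 0 <= 1 + theta by rewrite addr_ge0// ltW.
apply: (@le_trans _ _ (mu * (rB - rA) + (1 + theta) * (tau ^+ 2 + e) * (rA + rB))).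
  by rewrite lerD2l ler_wpM2r ?addr_ge0// ler_wpM2l.
(* The choice mu = (1 + theta) tau^2 makes the rank of [Ah] cancel, except in the excess of D^2 over
   tau^2, where N bounds it. *)
have -> : mu * (rB - rA) + (1 + theta) * (tau ^+ 2 + e) * (rA + rB) =
  2 * mu * rB + (1 + theta) * e * (rA + rB) by rewrite /mu; ring.
apply: lerD.
  by rewrite ler_wpM2l// mulr_ge0// mulr_ge0// sqr_ge0.
have -> : 2 * (1 + theta) * N%:R * e = (1 + theta) * e * (2 * N%:R) by ring.
by rewrite ler_wpM2l ?mulr_ge0//; lra.
Qed.

End LossBounds.

Lemma row_projector (R : realType) m p (X : 'M[R]_(m, p)) :
  exists Q : 'M[R]_(\rank X, m), Q *m Q^T = 1%:M /\ Q^T *m Q *m X = X.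
Proof.
rewrite -mxrank_tr; have [Q [QQ QX]] := gram_schmidt X^T; exists Q; split=> //.
have /submxP[B XB] : (X^T <= Q)%MS by rewrite QX.
have {}XB : X = Q^T *m B^T by rewrite -trmx_mul -XB trmxK.
transitivity (Q^T *m Q *m (Q^T *m B^T)); first by congr (_ *m _).
by rewrite mulmxA -[Q^T *m Q *m Q^T]mulmxA QQ mulmx1 -XB.
Qed.

Lemma measurable_loss (R : realType) (d : measure_display) (T : measurableType d)
    (P : probability T R) m n p (X : 'M[R]_(m, p)) (C : 'M[R]_(m, n))
    (Ah : 'M[{RV P >-> R}]_(p, n)) :
  measurable_fun setT (fun w => fsq (X *m realization Ah w - C)).
Proof.
rewrite (_ : (fun _ => _) = fun w =>
    \sum_i \sum_j ((\sum_k X i k * Ah k j w) - C i j) ^+ 2); last first.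
  apply/funext => w; rewrite fsqE; apply: eq_bigr => i _; apply: eq_bigr => j _.
  by rewrite !mxE; congr ((_ - _) ^+ 2); apply: eq_bigr => k _; rewrite mxE.
apply: measurable_sum => i; apply: measurable_sum => j.
apply: measurable_funX; apply: measurable_funB => //.
by apply: measurable_sum => k; exact: measurable_funM.
Qed.

Section Moments.
Context {R : realType} {d : measure_display} {T : measurableType d}.
Variables (P : probability T R) (loss : T -> R) (Psi : T -> \bar R) (F a : R).
Hypotheses (mloss : measurable_fun setT loss) (mPsi : measurable_fun setT Psi).
Hypotheses (Psi0 : forall w, (0 <= Psi w)%E) (IPsi : (\int[P]_w Psi w <= (expR a)%:E)%E).

Lemma probability_le_exp b : (forall w, F < loss w -> ((expR b)%:E <= Psi w)%E) ->
  ((1 - expR (a - b))%R%:E <= P [set w | (loss w <= F)%R])%E.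
Proof.
move=> FPsi; set G := [set w | _].
have mG : measurable G.
  rewrite (_ : G = setT `&` loss @^-1` `]-oo, F]%classic); last first.
    by apply/seteqP; split=> w; rewrite /= in_itv/= => // -[].
  exact: mloss.
have mGC : measurable (~` G) by exact: measurableC.
have PGC : (P (~` G) <= (expR (a - b))%:E)%E.
  rewrite expRB EFinM lee_pdivlMr ?expR_gt0//.
  rewrite muleC -integral_cst//.
  apply: (le_trans _ IPsi).
  apply: (@le_trans _ _ (\int[P]_(w in ~` G) Psi w)%E).
    apply: ge0_le_integral => //.
    - by move=> w _; rewrite lee_fin expR_ge0.
    - exact: measurable_funTS.
    - by move=> w /= /negP; rewrite -ltNge => /FPsi.
  exact: ge0_subset_integral.
have PG : P G = (1 - P (~` G))%E by rewrite -probability_setC// setCK.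
rewrite PG EFinB; exact: leeB.
Qed.

Lemma expectation_le_exp C : 0 <= F -> 0 <= C -> (forall w, 0 <= loss w) ->
  (forall w, ((loss w)%:E <= F%:E + C%:E * Psi w)%E) ->
  ('E_P[loss] <= (F + C * expR a)%R%:E)%E.
Proof.
move=> F0 C0 loss0 lossE; rewrite unlock.
have mCPsi : measurable_fun setT (fun w => C%:E * Psi w)%E by exact: measurable_funeM.
have CPsi0 w : (0 <= C%:E * Psi w)%E by rewrite mule_ge0.
apply: (@le_trans _ _ (\int[P]_w (F%:E + C%:E * Psi w))%E).
  apply: ge0_le_integral => //.
  - by move=> w _; rewrite lee_fin.
  - exact/measurable_EFinP.
  - by apply: emeasurable_funD.
have IF : (\int[P]_w F%:E = F%:E)%E.
  rewrite integral_cst// -[RHS]mule1; congr (_ * _)%E; exact: probability_setT.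
rewrite ge0_integralD// IF ge0_integralZl//.
by rewrite EFinD EFinM leeD2l// lee_wpmul2l.
Qed.

End Moments.

Theorem corollary8 (R : realType) (d : measure_display) (T : measurableType d)
    (P : probability T R) (m n p : nat) (n_gt0 : (0 < n)%N) (p_gt0 : (0 < p)%N)
    (X : 'M[R]_(m, p)) (A : 'M[R]_(p, n))
    (E : 'M[{RV P >-> R}]_(m, n)) (Ahat : 'M[{RV P >-> R}]_(p, n))
    (sigma theta xi : R)
    (sigma_gt0 : 0 < sigma) (theta_gt0 : 0 < theta) (xi_gt0 : 0 < xi)
    (E_indep : mutually_independent (fun ij : 'I_m * 'I_n => E ij.1 ij.2))
    (E_normal : forall (i : 'I_m) (j : 'I_n) (V : set R), measurable V ->
      distribution P (E i j) V = normal_prob 0 sigma V) :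
  let Y : T -> 'M[R]_(m, n) := fun w => X *m A + realization E w in
  let q : nat := \rank X in
  let c := 1 + 2 / theta in
  let mu := (1 + theta) * (1 + xi) ^+ 2
            * (Num.sqrt n%:R + Num.sqrt q%:R) ^+ 2 * sigma ^+ 2 in
  let pen := fun B : 'M[R]_(p, n) => mu * (\rank B)%:R in
  let loss := fun w : T =>
    frobenius_norm (X *m realization Ahat w - X *m A) ^+ 2 in
  let tail := fun k : nat =>
    \sum_(k.+1 <= j < n.+1) singval (X *m A) j ^+ 2 in
  (forall (w : T) (B : 'M[R]_(p, n)),
    frobenius_norm (Y w - X *m realization Ahat w) ^+ 2
      + pen (realization Ahat w)
    <= frobenius_norm (Y w - X *m B) ^+ 2 + pen B) ->
  ((1 - expR (- (xi ^+ 2 * (n + q)%:R / 2)))%:E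
   <= P [set w | (loss w <= min_upto (minn n p) (fun k : nat =>
                    c ^+ 2 * tail k + 2 * c * mu * k%:R))%R])%E
  /\
  ('E_P[loss]
   <= (min_upto (minn n p) (fun k : nat =>
         c ^+ 2 * tail k
         + 2 * (1 + theta) * c * (1 + xi) ^+ 2 * sigma ^+ 2
           * (Num.sqrt n%:R + Num.sqrt q%:R) ^+ 2 * k%:R)
       + 4 * (1 + theta) * c * (minn n p)%:R * sigma ^+ 2 * (1 + xi^-1)
         * expR (- (xi ^+ 2 * (n + q)%:R / 2)))%:E)%E.
Proof.
move=> Y q c mu pen loss tail opt.
set s := Num.sqrt n%:R + Num.sqrt q%:R in mu pen opt *.
have N0 : (0 < minn n p)%N by rewrite leq_min n_gt0.
have t1 : 0 < 1 + theta by rewrite addr_gt0.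
have c0 : 0 < c by rewrite addr_gt0// divr_gt0.
have mu0 : 0 <= mu by rewrite mulr_ge0 ?sqr_ge0// mulr_ge0 ?sqr_ge0// mulr_ge0 ?sqr_ge0// ltW.
have s2 : (n + q)%:R <= s ^+ 2.
  by rewrite sqrrD !sqr_sqrtr ?ler0n// natrD lerD2r lerDl mulrn_wge0//.
have exp_le : expR (- (xi ^+ 2 * s ^+ 2 / 2)) <= expR (- (xi ^+ 2 * (n + q)%:R / 2)).
  by rewrite ler_expR lerN2 ler_wpM2r ?invr_ge0// ler_wpM2l// sqr_ge0.
have -> : (fun k : nat => c ^+ 2 * tail k
    + 2 * (1 + theta) * c * (1 + xi) ^+ 2 * sigma ^+ 2 * s ^+ 2 * k%:R) =
    (fun k : nat => c ^+ 2 * tail k + 2 * c * mu * k%:R).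
  by apply/funext => k; rewrite /mu; ring.
set F := min_upto _ _.
have F0 : 0 <= F.
  apply: le_min_upto => // k _; apply: addr_ge0.
    by rewrite mulr_ge0 ?sqr_ge0// sumr_ge0// => j _; exact: sqr_ge0.
  by rewrite mulr_ge0// mulr_ge0// mulr_ge0// ltW.
have loss0 w : 0 <= loss w by exact: sqr_ge0.
have lossE w : loss w = fsq (X *m realization Ahat w - X *m A).
  exact: frobenius_norm_sqr.
have mloss : measurable_fun setT loss.
  rewrite (_ : loss = fun w => fsq (X *m realization Ahat w - X *m A)).
    exact: measurable_loss.
  exact/funext.
have bound0 : 0 <= 4 * (1 + theta) * c * (minn n p)%:R * sigma ^+ 2 * (1 + xi^-1)
    * expR (- (xi ^+ 2 * (n + q)%:R / 2)).
  rewrite mulr_ge0 ?expR_ge0// mulr_ge0 ?addr_ge0 ?invr_ge0 ?(ltW xi_gt0)//.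
  by rewrite mulr_ge0 ?sqr_ge0// mulr_ge0// mulr_ge0 ?(ltW c0)// mulr_ge0 ?(ltW t1).
(* For q = 0 there are no unit vectors on the side of [Q] and s may be less than 2, but then X = 0
   and the loss vanishes. *)
have [q0|q0] := posnP q.
  have X0 : X = 0 by apply/eqP; rewrite -mxrank_eq0 -/q q0.
  have loss_eq0 w : loss w = 0.
    by rewrite lossE X0 !mul0mx subrr fsqE big1// => i _; rewrite big1// => j _; rewrite mxE expr0n.
  split.
    rewrite (_ : [set w | _] = setT); last first.
      by apply/seteqP; split=> // w _ /=; rewrite loss_eq0.
    by rewrite probability_setT lee_fin gerBl expR_ge0.
  rewrite unlock (_ : (fun _ => _) = cst 0%E); last by apply/funext => w; rewrite /= loss_eq0.
  by rewrite integral0 lee_fin addr_ge0.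
have [Q [QQ QX]] := row_projector X.
pose Z (ij : 'I_m * 'I_n) : {RV P >-> R} := E ij.1 ij.2.
have iidZ : iid_normal Z sigma P (enum {: 'I_m * 'I_n}).
  move=> J B _ mB; rewrite E_indep//; apply: eq_bigr => ij _; exact: E_normal.
pose tau := (1 + xi) * s * sigma.
have muE : mu = (1 + theta) * tau ^+ 2 by rewrite /mu /tau; ring.
pose C := 2 * c * (1 + theta) * (minn n p)%:R.
have C0 : 0 <= C by rewrite mulr_ge0// mulr_ge0 ?(ltW t1)// mulr_ge0 ?(ltW c0).
have loss_le w D : 0 <= D -> opbound (Q *m (\matrix_(i, j) Z (i, j) w)) D ->
    loss w <= F + C * Num.max 0 (D ^+ 2 - tau ^+ 2).
  move=> D0 GD; rewrite -lerBlDr; apply: le_min_upto => // k /andP[_ kN].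
  rewrite lerBlDr lossE /mu -/mu muE.
  apply: (loss_le_excess theta_gt0 D0 QQ QX GD) => // B.
  by have := opt w B; rewrite !frobenius_norm_sqr /pen muE; exact.
have tau0 : 0 < tau.
  rewrite mulr_gt0// mulr_gt0 ?addr_gt0// sqrtr_gt0 ltr0n//.
have s0 : 0 < s by rewrite addr_gt0// sqrtr_gt0 ltr0n.
split.
  (* This value minimises lam sigma s + lam^2 sigma^2 / 2 - lam tau; the minimum is - xi^2 s^2 / 2,
     and s^2 >= n + q. *)
  pose lam := xi * s / sigma.
  have lam0 : 0 < lam by rewrite divr_gt0// mulr_gt0.
  have [Psi [mPsi Psi0 IPsi PsiE]] := integrable_exp_opbound q0 n_gt0 QQ lam0 sigma_gt0 iidZ.
  apply: (@le_trans _ _ (1 - expR (lam * sigma * s + lam ^+ 2 * sigma ^+ 2 / 2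
      - lam * tau))%:E).
    rewrite lee_fin lerD2l lerN2; apply: le_trans exp_le.
    rewrite ler_expR le_eqVlt; apply/orP; left; apply/eqP.
    by rewrite /lam /tau; field; rewrite gt_eqF.
  apply: (probability_le_exp mloss mPsi Psi0 IPsi) => w Fw.
  have [->|[D [GD ->]]] := PsiE w; first exact: leey.
  rewrite lee_fin ler_expR ler_pM2l//; have [//|Dtau] := leP tau D.
  have D0 := opbound_ge0 q0 n_gt0 GD.
  move: Fw; rewrite ltNge => /negP[]; have := loss_le w D D0 GD.
  have /max_idPl -> : D ^+ 2 - tau ^+ 2 <= 0.
    by rewrite subr_le0 lerXn2r ?nnegrE// ltW.
  by rewrite mulr0 addr0.
have s_ge2 : 2 <= s.
  have sqrt1 r : (0 < r)%N -> 1 <= Num.sqrt r%:R :> R.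
    by move=> r0; rewrite -[X in X <= _]sqrtr1 ler_sqrt ?ltr0n// ler1n.
  by have := sqrt1 _ n_gt0; have := sqrt1 _ q0; rewrite /s; lra.
have [lam [k [lam0 k0 kE kexp]]] := excess_le_expR sigma_gt0 xi_gt0 s_ge2.
have [Psi [mPsi Psi0 IPsi PsiE]] := integrable_exp_opbound q0 n_gt0 QQ lam0 sigma_gt0 iidZ.
pose C' := C * (k * expR (- (lam * tau))).
have C'0 : 0 < C'.
  rewrite !mulr_gt0 ?expR_gt0// ltr0n//.
have lossPsi w : ((loss w)%:E <= F%:E + C'%:E * Psi w)%E.
  have [->|[D [GD ->]]] := PsiE w; first by rewrite gt0_muley ?lte_fin// addey// leey.
  have D0 := opbound_ge0 q0 n_gt0 GD.
  rewrite -EFinM -EFinD lee_fin; apply: le_trans (loss_le w D D0 GD) _.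
  rewrite lerD2l -[leRHS]mulrA ler_wpM2l// -mulrA -expRD.
  rewrite ge_max mulr_ge0 ?expR_ge0 ?(ltW k0)//=.
  have [tD|Dtau] := leP tau D.
    have -> : - (lam * tau) + lam * D = lam * (D - tau) by ring.
    exact: kE.
  apply: (@le_trans _ _ 0); last by rewrite mulr_ge0 ?expR_ge0 ?(ltW k0).
  by rewrite subr_le0 lerXn2r ?nnegrE// ltW.
apply: le_trans (expectation_le_exp mloss mPsi Psi0 IPsi F0 (ltW C'0) loss0 lossPsi) _.
rewrite lee_fin lerD2l; rewrite expRD mulrA in kexp; rewrite /C' -[leLHS]mulrA.
apply: le_trans (ler_wpM2l C0 kexp) _.
have -> : C * (2 * sigma ^+ 2 * (1 + xi^-1) * expR (- (xi ^+ 2 * s ^+ 2 / 2))) =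
    4 * (1 + theta) * c * (minn n p)%:R * sigma ^+ 2 * (1 + xi^-1)
    * expR (- (xi ^+ 2 * s ^+ 2 / 2)) by rewrite /C; ring.
apply: ler_wpM2l exp_le.
rewrite mulr_ge0 ?addr_ge0 ?invr_ge0 ?(ltW xi_gt0)//.
by rewrite mulr_ge0 ?sqr_ge0// mulr_ge0// mulr_ge0 ?(ltW c0)// mulr_ge0 ?(ltW t1).
Qed.
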